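(* Let $\mathcal{M}$ be an $N$-manifold (nonnegatively graded manifold) with underlying degree $0$ manifold $M$ and projection $\pi_{\mathcal{M}}:\mathcal{M}\to M$. Let $\mathcal{B}\to\mathcal{M}$ be a degree-bounded vector bundle in the category of graded manifolds, and let $\mathcal{E}=0_{\mathcal{M}}^*\mathcal{B}\to M$ be the standard graded vector bundle associated to $\mathcal{B}$. Then $\mathcal{B}$ is (noncanonically) isomorphic to $\pi_{\mathcal{M}}^*\mathcal{E}$ as a vector bundle over $\mathcal{M}$.
   Context: An $N$-manifold $\mathcal{M}$ is a $\mathbb{Z}$-graded manifold whose local coordinates all have nonnegative degree; the parity of a function agrees with its degree. Its degree $0$ functions are identified with $C^\infty(M)$ for an ordinary smooth manifold $M$. The projection $\pi_{\mathcal{M}}:\mathcal{M}\to M$ is the map whose pullback identifies $C^\infty(M)$ with the degree $0$ functions on $\mathcal{M}$. The zero embedding $0_{\mathcal{M}}:M\to\mathcal{M}$ is the map whose pullback annihilates the ideal of functions generated by those of positive degree; $\pi_{\mathcal{M}}\circ 0_{\mathcal{M}}=\mathrm{id}_M$. A vector bundle $\mathcal{B}\to\mathcal{M}$ is given by its sheaf of sections $\Gamma(\mathcal{B})$, a locally free $\mathbb{Z}$-graded $C^\infty(\mathcal{M})$-module; $\mathrm{rk}_i(\mathcal{B})$ denotes its rank in degree $i$ (the number of degree $i$ elements in a local homogeneous frame), which is finite. $\mathcal{B}$ is degree-bounded if there are integers $m,n$ with $\mathrm{rk}_i(\mathcal{B})=0$ for $i<m$ and for $i>n$. (The total space of $\mathcal{B}$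 may be $\mathbb{Z}$-graded.) Isomorphisms of vector bundles over $\mathcal{M}$ are degree-preserving, $C^\infty(\mathcal{M})$-linear, and cover the identity of $\mathcal{M}$. The pullback $0_{\mathcal{M}}^*\mathcal{B}$ is a graded vector bundle over $M$, so it splits canonically as $\mathcal{E}=\bigoplus_i E_i[-i]$, where the $E_i$ are ordinary vector bundles over $M$ and $\Gamma(E_i[-i])$ is $\Gamma(E_i)$ placed in degree $i$. This $\mathcal{E}$ is the standard graded vector bundle associated to $\mathcal{B}$. The pullback bundle $\pi_{\mathcal{M}}^*\mathcal{E}$ has sections $C^\infty(\mathcal{M})\otimes_{C^\infty(M)}\Gamma(\mathcal{E})$. *)

(* Defs.v *)
From HB Require Import structures.
From mathcomp Require Import all_boot all_order all_algebra.
From mathcomp Require Import all_classical all_reals all_analysis.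

Set Implicit Arguments.
Unset Strict Implicit.
Unset Printing Implicit Defensive.

Import Order.TTheory GRing.Theory Num.Theory.
Import numFieldNormedType.Exports.

Local Open Scope classical_set_scope.
Local Open Scope ring_scope.

Record openSet (T : topologicalType) := OpenSet {
  pts :> set T;
  ptsP : open pts }.

Definition openSetI (T : topologicalType) (U V : openSet T) : openSet T :=
  OpenSet (openI (ptsP U) (ptsP V)).

(* A sheaf in the category of Z-graded abelian groups is given by its
   homogeneous components: [sec U k] is the group of sections of degree [k]
   over [U].  Only homogeneous sections are ever added. *)
Record grSheaf (T : topologicalType) := GrSheaf {
  sec :> openSet T -> int -> zmodType;
  res : forall U V : openSet T, V `<=` U ->
          forall k : int, {additive sec U k -> sec V k};
  res_id : forall (U : openSet T) (h : U `<=` U) k (s : sec U k), res h k s = s;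
  res_comp : forall (U V W : openSet T) (hVU : V `<=` U) (hWV : W `<=` V) (hWU : W `<=` U)
               k (s : sec U k),
      res hWV k (res hVU k s) = res hWU k s;
  sheaf_locality : forall (U : openSet T) (I : Type) (V : I -> openSet T)
                     (hV : forall i, V i `<=` U),
      U `<=` \bigcup_i V i ->
      forall k (s t : sec U k),
        (forall i, res (hV i) k s = res (hV i) k t) -> s = t;
  sheaf_gluing : forall (U : openSet T) (I : Type) (V : I -> openSet T)
                   (hV : forall i, V i `<=` U),
      U `<=` \bigcup_i V i ->
      forall k (s : forall i, sec (V i) k),
        (forall i j (W : openSet T) (hi : W `<=` V i) (hj : W `<=` V j),
            res hi k (s i) = res hj k (s j)) ->
        exists t : sec U k, forall i, res (hV i) k t = s i }.

(* Products land in degree [k] for any [k] equipped with a proof that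
   [i + j = k]; this replaces transports along equations of degrees. *)
Record grRing (T : topologicalType) := GrRing {
  gr_sheaf :> grSheaf T;
  gr_one : forall U, gr_sheaf U 0;
  gr_mul : forall U (i j k : int), i + j = k ->
             gr_sheaf U i -> gr_sheaf U j -> gr_sheaf U k;
  gr_mulDl : forall U i j k (e : i + j = k) (a b : gr_sheaf U i)
               (c : gr_sheaf U j),
      gr_mul e (a + b) c = gr_mul e a c + gr_mul e b c;
  gr_mulDr : forall U i j k (e : i + j = k) (a : gr_sheaf U i)
               (b c : gr_sheaf U j),
      gr_mul e a (b + c) = gr_mul e a b + gr_mul e a c;
  gr_mulA : forall U i j k ij jk n (eij : i + j = ij) (ejk : j + k = jk)
              (el : ij + k = n) (er : i + jk = n)
              (a : gr_sheaf U i) (b : gr_sheaf U j) (c : gr_sheaf U k),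
      gr_mul el (gr_mul eij a b) c = gr_mul er a (gr_mul ejk b c);
  gr_mul1 : forall U i (e : 0 + i = i) (a : gr_sheaf U i),
      gr_mul e (gr_one U) a = a;
  gr_mulC : forall U i j k (e : i + j = k) (e' : j + i = k)
              (a : gr_sheaf U i) (b : gr_sheaf U j),
      gr_mul e a b = gr_mul e' b a *~ (-1) ^+ (`|i| * `|j|)%N;
  res_one : forall (U V : openSet T) (h : V `<=` U),
      res gr_sheaf h 0 (gr_one U) = gr_one V;
  res_mul : forall (U V : openSet T) (h : V `<=` U) i j k (e : i + j = k)
              (a : gr_sheaf U i) (b : gr_sheaf U j),
      res gr_sheaf h k (gr_mul e a b)
      = gr_mul e (res gr_sheaf h i a) (res gr_sheaf h j b) }.

Lemma gr_mul0l (T : topologicalType) (O : grRing T) U i j k (e : i + j = k)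
  (b : O U j) : gr_mul e (0 : O U i) b = 0.
Proof. by apply: (addrI (gr_mul e 0 b)); rewrite -gr_mulDl !addr0. Qed.

Lemma gr_mul0r (T : topologicalType) (O : grRing T) U i j k (e : i + j = k)
  (a : O U i) : gr_mul e a (0 : O U j) = 0.
Proof. by apply: (addrI (gr_mul e a 0)); rewrite -gr_mulDr !addr0. Qed.

Record grModule (T : topologicalType) (O : grRing T) := GrModule {
  mod_sheaf :> grSheaf T;
  act : forall U (i j k : int), i + j = k ->
          O U i -> mod_sheaf U j -> mod_sheaf U k;
  actDl : forall U i j k (e : i + j = k) (a b : O U i) (s : mod_sheaf U j),
      act e (a + b) s = act e a s + act e b s;
  actDr : forall U i j k (e : i + j = k) (a : O U i) (s t : mod_sheaf U j),
      act e a (s + t) = act e a s + act e a t;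
  actA : forall U i j k ij jk n (eij : i + j = ij) (ejk : j + k = jk)
           (el : ij + k = n) (er : i + jk = n)
           (a : O U i) (b : O U j) (s : mod_sheaf U k),
      act el (gr_mul eij a b) s = act er a (act ejk b s);
  act1 : forall U i (e : 0 + i = i) (s : mod_sheaf U i),
      act e (gr_one O U) s = s;
  res_act : forall (U V : openSet T) (h : V `<=` U) i j k (e : i + j = k)
              (a : O U i) (s : mod_sheaf U j),
      res mod_sheaf h k (act e a s)
      = act e (res O h i a) (res mod_sheaf h j s) }.

Record grHom (T : topologicalType) (F G : grSheaf T) := GrHom {
  hom_fun :> forall U k, {additive F U k -> G U k};
  hom_res : forall (U V : openSet T) (h : V `<=` U) k (s : F U k),
      hom_fun V k (res F h k s) = res G h k (hom_fun U k s) }.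

Record grRingHom (T : topologicalType) (O O' : grRing T) := GrRingHom {
  ring_hom :> grHom O O';
  ring_hom1 : forall U, ring_hom U 0 (gr_one O U) = gr_one O' U;
  ring_homM : forall U i j k (e : i + j = k) (a : O U i) (b : O U j),
      ring_hom U k (gr_mul e a b)
      = gr_mul e (ring_hom U i a) (ring_hom U j b) }.

Definition semilinear (T : topologicalType) (O O' : grRing T)
    (phi : grRingHom O O') (B : grModule O) (B' : grModule O')
    (h : grHom B B') : Prop :=
  forall U i j k (e : i + j = k) (a : O U i) (s : B U j),
    h U k (act e a s) = act e (phi U i a) (h U j s).

Definition grlinear (T : topologicalType) (O : grRing T) (B B' : grModule O)
    (h : grHom B B') : Prop :=
  forall U i j k (e : i + j = k) (a : O U i) (s : B U j),
    h U k (act e a s) = act e a (h U j s).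

(* A graded ring homomorphism [phi : O -> O'] is the pullback of functions
   along a morphism of graded ringed spaces [f : (T, O') -> (T, O)] over the
   identity of [T].  The pullback [f^* B], i.e. the [O']-module
   [O' (x)_O B], is characterized together with the pullback of sections
   [rho : B -> f^* B] by the universal property of the tensor product. *)
Definition is_pullback (T : topologicalType) (O O' : grRing T)
    (phi : grRingHom O O') (B : grModule O) (B' : grModule O')
    (rho : grHom B B') : Prop :=
  semilinear phi rho /\
  forall (F : grModule O') (h : grHom B F), semilinear phi h ->
    exists g : grHom B' F,
      [/\ grlinear g,
          forall U k (s : B U k), g U k (rho U k s) = h U k s &
          forall g' : grHom B' F, grlinear g' ->
            (forall U k (s : B U k), g' U k (rho U k s) = h U k s) ->
            forall U k (t : B' U k), g' U k t = g U k t].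

Section AsModule.
Variables (T : topologicalType) (O O' : grRing T) (phi : grRingHom O O').

Definition scal (U : openSet T) (i j k : int) (e : i + j = k)
  (a : O U i) (b : O' U j) : O' U k := gr_mul e (phi U i a) b.

Fact scalDl U i j k (e : i + j = k) (a b : O U i) (s : O' U j) :
  scal e (a + b) s = scal e a s + scal e b s.
Proof. by rewrite /scal raddfD gr_mulDl. Qed.

Fact scalDr U i j k (e : i + j = k) (a : O U i) (s t : O' U j) :
  scal e a (s + t) = scal e a s + scal e a t.
Proof. exact: gr_mulDr. Qed.

Fact scalA U i j k ij jk n (eij : i + j = ij) (ejk : j + k = jk)
    (el : ij + k = n) (er : i + jk = n)
    (a : O U i) (b : O U j) (s : O' U k) :
  scal el (gr_mul eij a b) s = scal er a (scal ejk b s).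
Proof. by rewrite /scal ring_homM; exact: gr_mulA. Qed.

Fact scal1 U i (e : 0 + i = i) (s : O' U i) : scal e (gr_one O U) s = s.
Proof. by rewrite /scal ring_hom1 gr_mul1. Qed.

Fact res_scal (U V : openSet T) (h : V `<=` U) i j k (e : i + j = k)
    (a : O U i) (s : O' U j) :
  res O' h k (scal e a s) = scal e (res O h i a) (res O' h j s).
Proof. by rewrite /scal res_mul hom_res. Qed.

Definition as_module : grModule O := GrModule scalDl scalDr scalA scal1 res_scal.

End AsModule.

Section Frame.
Variables (T : topologicalType) (O : grRing T) (F : grModule O).
Variables (U : openSet T) (J : eqType) (dg : J -> int).
Variable e : forall j, F U (dg j).

Definition combination (W : openSet T) (hWU : W `<=` U) (k : int) (s : seq J)
    (c : forall j, O W (k - dg j)) : F W k :=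
  \sum_(j <- s) act (subrK (dg j) k) (c j) (res F hWU (dg j) (e j)).

(* The [e j] exhibit the restriction of [F] to [U] as a free module, i.e. as
   the (sheaf) direct sum of copies of [O] shifted by the degrees [dg j].
   For an infinite [J], a section is only locally a finite combination. *)
Definition homogeneous_frame : Prop :=
  (forall (W : openSet T) (hWU : W `<=` U) k (s : seq J) c,
      uniq s -> combination hWU s c = 0 :> F W k ->
      forall j, j \in s -> c j = 0) /\
  (forall (W : openSet T) (hWU : W `<=` U) k (f : F W k) x, pts W x ->
      exists (W' : openSet T) (hW' : W' `<=` W) (s : seq J) c,
        pts W' x /\
        res F hW' k f = combination (subset_trans hW' hWU) s c).

End Frame.

Record vectorBundle (T : topologicalType) (O : grRing T) := VectorBundle {
  sections :> grModule O;
  rk : int -> nat;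
  local_frame : forall x : T, exists U : openSet T, pts U x /\
      exists e : forall j : {i : int & 'I_(rk i)}, sections U (tag j),
        homogeneous_frame e }.

Definition degree_bounded (T : topologicalType) (O : grRing T)
    (B : vectorBundle O) : Prop :=
  exists m n : int, forall i : int, (i < m) || (n < i) -> rk B i = 0%N.

Definition vb_isomorphic (T : topologicalType) (O : grRing T)
    (B B' : vectorBundle O) : Prop :=
  exists f : grHom B B', grlinear f /\ forall U k, bijective (f U k).

Section SmoothEuclidean.
Variables (R : realType) (n : nat).
Implicit Types (V W : set 'rV[R]_n) (f g : 'rV[R]_n -> R).

(* Existence and continuity on [V] of all partial derivatives of order at
   most [k]. *)
Fixpoint Ck (k : nat) V f : Prop :=
  (forall x, V x -> {for x, continuous f}) /\
  if k is k'.+1 then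
    forall j : 'I_n, (forall x, V x -> derivable f x 'e_j) /\
                     Ck k' V (fun x => 'D_('e_j) f x)
  else True.

Definition smooth V f : Prop := forall k, Ck k V f.

Lemma CkW k V W f : W `<=` V -> Ck k V f -> Ck k W f.
Proof.
move=> WV; elim: k f => [|k IH] f /= [cf df]; split=> //.
  by move=> x /WV; exact: cf.
  by move=> x /WV; exact: cf.
move=> j; have [d1 d2] := df j; split; last exact: IH.
by move=> x /WV; exact: d1.
Qed.

Lemma eq_on_continuous W f g x : open W -> W x ->
  (forall y, W y -> f y = g y) -> {for x, continuous g} -> {for x, continuous f}.
Proof.
move=> oW Wx fg cg; rewrite /prop_for /continuous_at (fg _ Wx).
apply: cvg_trans cg; apply: (@near_eq_cvg _ _ (nbhs x) _ g f).
have : nbhs x W by exact: open_nbhs_nbhs.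
by apply: (@filterS _ (nbhs x)) => z /fg ->.
Qed.

Lemma Ck_local k V f :
  (forall x, V x -> exists W g,
     [/\ open W, W x, Ck k W g & forall y, W y -> f y = g y]) ->
  Ck k V f.
Proof.
have dgf W g h : open W -> (forall y, W y -> h y = g y) ->
    forall y, W y -> \near y, g y = h y.
  move=> oW fg y Wy; have : nbhs y W by exact: open_nbhs_nbhs.
  by apply: (@filterS _ (nbhs y)) => z /fg ->.
elim: k V f => [|k IH] V f H.
  split=> // x /H[W [g [oW Wx [cg _] fg]]].
  exact: eq_on_continuous oW Wx fg (cg _ Wx).
split.
  move=> x /H[W [g [oW Wx [cg _] fg]]].
  exact: eq_on_continuous oW Wx fg (cg _ Wx).
move=> j; split.
  move=> x /H[W [g [oW Wx [_ dg] fg]]].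
  apply: (@near_eq_derivable _ _ _ g); last exact: (dg j).1.
  exact: (dgf _ _ _ oW fg _ Wx).
apply: IH => x /H[W [g [oW Wx [_ dg] fg]]].
exists W, (fun y => 'D_('e_j) g y); split=> //; first exact: (dg j).2.
by move=> y Wy; apply/esym/near_eq_derive; exact: (dgf _ _ _ oW fg _ Wy).
Qed.

Lemma Ck_cst k V (a : R) : Ck k V (fun=> a).
Proof.
have cc (b : R) x : V x -> {for x, continuous (fun=> b : R)}.
  by move=> _; exact: cst_continuous.
elim: k a => [|k IH] a; split=> //; try by move=> x; exact: cc.
move=> j; split; first by move=> x _; exact: derivable_cst.
suff -> : (fun x => 'D_('e_j) (fun=> a) x) = (fun=> 0) :> ('rV[R]_n -> R).
  exact: IH.
by apply/funext => x; exact: derive_cst.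
Qed.

Lemma CkD k V f g : open V -> Ck k V f -> Ck k V g -> Ck k V (f + g).
Proof.
move=> oV; elim: k f g => [|k IH] f g [cf df] [cg dg]; split=> //.
- by move=> x Vx; exact: continuousD (cf _ Vx) (cg _ Vx).
- by move=> x Vx; exact: continuousD (cf _ Vx) (cg _ Vx).
move=> j; have [df1 df2] := df j; have [dg1 dg2] := dg j; split.
  by move=> x Vx; apply: derivableD; [exact: df1|exact: dg1].
apply: Ck_local => x Vx.
exists V, ((fun y => 'D_('e_j) f y) + (fun y => 'D_('e_j) g y)).
split=> //; first exact: IH.
by move=> y Vy; rewrite deriveD //; [exact: df1|exact: dg1].
Qed.

Lemma CkM k V f g : open V -> Ck k V f -> Ck k V g -> Ck k V (f * g).
Proof.
move=> oV; elim: k f g => [|k IH] f g Cf Cg.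
  by split=> // x Vx; exact: continuousM (Cf.1 _ Vx) (Cg.1 _ Vx).
have CkS h : Ck k.+1 V h -> Ck k V h.
  elim: {Cf Cg IH f g} k h => [|k IH] h [ch dh]; split=> //.
  by move=> j; have [d1 d2] := dh j; split=> //; exact: IH.
have [cf df] := Cf; have [cg dg] := Cg; split.
  by move=> x Vx; exact: continuousM (cf _ Vx) (cg _ Vx).
move=> j; have [df1 df2] := df j; have [dg1 dg2] := dg j; split.
  by move=> x Vx; apply: derivableM; [exact: df1|exact: dg1].
apply: Ck_local => x Vx.
exists V, (f * (fun y => 'D_('e_j) g y) + g * (fun y => 'D_('e_j) f y)).
split=> //; first apply: CkD => //.
    by apply: IH; [exact: CkS Cf|exact: dg2].
  by apply: IH; [exact: CkS Cg|exact: df2].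
by move=> y Vy; rewrite deriveM //; [exact: df1|exact: dg1].
Qed.

End SmoothEuclidean.

Section Chart.
Variables (R : realType) (T : topologicalType) (n : nat).

(* [chart_map] and [chart_inv] are only meaningful on [chart_dom] and
   [chart_cod], between which they are mutually inverse homeomorphisms. *)
Record chart := Chart {
  chart_dom : set T;
  chart_cod : set 'rV[R]_n;
  chart_map : T -> 'rV[R]_n;
  chart_inv : 'rV[R]_n -> T;
  chart_dom_open : open chart_dom;
  chart_cod_open : open chart_cod;
  chart_mapP : forall x, chart_dom x -> chart_cod (chart_map x);
  chart_invP : forall y, chart_cod y -> chart_dom (chart_inv y);
  chart_mapK : forall x, chart_dom x -> chart_inv (chart_map x) = x;
  chart_invK : forall y, chart_cod y -> chart_map (chart_inv y) = y;
  chart_map_cont : forall x, chart_dom x -> {for x, continuous chart_map};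
  chart_inv_cont : forall y, chart_cod y -> {for y, continuous chart_inv} }.

Definition chart_img (c : chart) (U : set T) : set 'rV[R]_n :=
  chart_cod c `&` chart_inv c @^-1` U.

Definition compatible (c d : chart) : Prop :=
  forall j : 'I_n, smooth (chart_img c (chart_dom d))
                          (fun y => chart_map d (chart_inv c y) 0 j).

Lemma chart_img_open c (U : set T) : open U -> open (chart_img c U).
Proof.
move=> oU; rewrite openE => y [cy Uy]; rewrite /interior /=.
have ncod : nbhs y (chart_cod c).
  by apply: open_nbhs_nbhs; split=> //; exact: chart_cod_open.
have nU : nbhs (chart_inv c y) U by exact: open_nbhs_nbhs.
exact: filterI ncod (chart_inv_cont cy nU).
Qed.

End Chart.

Record smoothManifold (R : realType) := SmoothManifold {
  mfd_space :> topologicalType;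
  mfd_hausdorff : hausdorff_space mfd_space;
  mfd_second_countable : @second_countable mfd_space;
  mfd_dim : nat;
  atlas : set (chart R mfd_space mfd_dim);
  atlas_cover : forall x, exists2 c, atlas c & chart_dom c x;
  atlas_compatible : forall c d, atlas c -> atlas d -> compatible c d }.

Section SmoothFunctions.
Variables (R : realType) (M : smoothManifold R).

Definition smooth_on (U : set M) (f : M -> R) : Prop :=
  forall c, atlas c -> smooth (chart_img c U) (f \o chart_inv c).

(* A smooth function on [U] is represented by its extension by zero to [M];
   in degrees other than 0 there is only the zero function. *)
Definition smoothfun_pred (U : openSet M) (k : int) : {pred M -> R} :=
  fun f => `[< [/\ smooth_on U f, forall x, ~ pts U x -> f x = 0 &
                   k != 0 -> f = 0] >].

Lemma smooth_on_local (U : set M) f :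
  (forall x, U x -> exists W g,
     [/\ open W, W x, smooth_on W g & forall y, W y -> f y = g y]) ->
  smooth_on U f.
Proof.
move=> H c ac k; apply: Ck_local => y [cy /H[W [g [oW Wx sg fg]]]].
exists (chart_img c W), (g \o chart_inv c); split => //.
- exact: chart_img_open.
- exact: sg.
- by move=> z [_ /fg].
Qed.

Lemma smooth_onW (U W : set M) f : W `<=` U -> smooth_on U f -> smooth_on W f.
Proof.
move=> WU sf c ac k; apply: CkW (sf c ac k).
by move=> y [cy /WU].
Qed.

Lemma smooth_onD (U : openSet M) f g :
  smooth_on U f -> smooth_on U g -> smooth_on U (f + g).
Proof.
move=> sf sg c ac k; apply: CkD; [|exact: sf|exact: sg].
exact/chart_img_open/ptsP.
Qed.

Lemma smooth_onM (U : openSet M) f g :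
  smooth_on U f -> smooth_on U g -> smooth_on U (f * g).
Proof.
move=> sf sg c ac k; apply: CkM; [|exact: sf|exact: sg].
exact/chart_img_open/ptsP.
Qed.

Lemma smooth_on_cst (U : set M) a : smooth_on U (fun=> a).
Proof. by move=> c ac k; exact: Ck_cst. Qed.

Lemma smooth_onN (U : openSet M) f : smooth_on U f -> smooth_on U (- f).
Proof.
move=> sf; rewrite (_ : - f = (fun=> -1 : R) * f).
  by apply: smooth_onM sf; exact: smooth_on_cst.
by apply/funext => x; rewrite /= fctE mulN1r.
Qed.

Lemma smoothfun_zmod_closed U k : zmod_closed (smoothfun_pred U k).
Proof.
split.
  by apply/asboolP; split=> //; exact: smooth_on_cst.
move=> f g /asboolP[sf zf kf] /asboolP[sg zg kg]; apply/asboolP; split.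
- by apply: smooth_onD => //; exact: smooth_onN.
- by move=> x Ux; rewrite !fctE zf // zg // subr0.
- by move=> k0; rewrite kf // kg // subr0.
Qed.
HB.instance Definition _ U k :=
  GRing.isZmodClosed.Build (M -> R) (smoothfun_pred U k)
    (smoothfun_zmod_closed U k).

Record smoothfun (U : openSet M) (k : int) := SmoothFun {
  smoothfun_val :> M -> R;
  smoothfun_valP : smoothfun_val \in smoothfun_pred U k }.
HB.instance Definition _ U k := [isSub for @smoothfun_val U k].
HB.instance Definition _ U k := [Choice of smoothfun U k by <:].
HB.instance Definition _ U k := [SubChoice_isSubZmodule of smoothfun U k by <:].

Lemma smoothfunP (U : openSet M) k (f : smoothfun U k) :
  [/\ smooth_on U f, forall x, ~ pts U x -> f x = 0 & k != 0 -> f = 0 :> (M -> R)].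
Proof. exact/asboolP/(smoothfun_valP f). Qed.

Lemma smoothfun_eq (U : openSet M) k (f g : smoothfun U k) :
  (forall x, pts U x -> f x = g x) -> f = g.
Proof.
move=> fg; apply: val_inj; apply/funext => x /=.
have [_ zf _] := smoothfunP f; have [_ zg _] := smoothfunP g.
by have [/fg//|Ux] := pselect (pts U x); rewrite zf // zg.
Qed.

Lemma smoothfun_deg (U : openSet M) k (f : smoothfun U k) : k != 0 -> f = 0.
Proof.
by move=> k0; apply: val_inj; have [_ _ /(_ k0)] := smoothfunP f.
Qed.

Lemma smoothfun_deg_eq (U : openSet M) k (f g : smoothfun U k) :
  k != 0 -> f = g.
Proof. by move=> k0; rewrite (smoothfun_deg f k0) (smoothfun_deg g k0). Qed.

Definition cut (V : set M) (f : M -> R) : M -> R :=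
  fun x => if `[< V x >] then f x else 0.

Lemma cutE (V : set M) f x : V x -> cut V f x = f x.
Proof. by move=> Vx; rewrite /cut asboolT. Qed.

Fact smoothfun_res_subproof (U V : openSet M) (h : V `<=` U) k
  (f : smoothfun U k) : cut V f \in smoothfun_pred V k.
Proof.
have [sf zf kf] := smoothfunP f; apply/asboolP; split.
- apply: smooth_on_local => x Vx; exists V, f; split => //.
  + exact: ptsP.
  + exact: smooth_onW sf.
  + by move=> y; exact: cutE.
- by move=> x Vx; rewrite /cut asboolF.
- by move=> /kf f0; apply/funext => x; rewrite /cut f0 if_same.
Qed.

Definition smoothfun_res (U V : openSet M) (h : V `<=` U) k
  (f : smoothfun U k) : smoothfun V k :=
  SmoothFun (smoothfun_res_subproof h f).

Lemma smoothfun_resE (U V : openSet M) (h : V `<=` U) k (f : smoothfun U k) x :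
  pts V x -> smoothfun_res h f x = f x.
Proof. exact: cutE. Qed.

Fact smoothfun_res_additive (U V : openSet M) (h : V `<=` U) k :
  zmod_morphism (@smoothfun_res U V h k).
Proof.
move=> f g; apply: smoothfun_eq => x Vx.
rewrite smoothfun_resE // -[RHS]/(smoothfun_res h f x - smoothfun_res h g x).
by rewrite !smoothfun_resE.
Qed.
HB.instance Definition _ (U V : openSet M) (h : V `<=` U) k :=
  GRing.isZmodMorphism.Build (smoothfun U k) (smoothfun V k)
    (@smoothfun_res U V h k) (@smoothfun_res_additive U V h k).

Fact smoothfun_res_id (U : openSet M) (h : U `<=` U) k (s : smoothfun U k) :
  smoothfun_res h s = s.
Proof. by apply: smoothfun_eq => x Ux; rewrite smoothfun_resE. Qed.

Fact smoothfun_res_comp (U V W : openSet M) (hVU : V `<=` U) (hWV : W `<=` V)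
    (hWU : W `<=` U) k (s : smoothfun U k) :
  smoothfun_res hWV (smoothfun_res hVU s) = smoothfun_res hWU s.
Proof.
apply: smoothfun_eq => x Wx; rewrite !smoothfun_resE //; exact: hWV.
Qed.

Fact smoothfun_locality (U : openSet M) (I : Type) (V : I -> openSet M)
    (hV : forall i, V i `<=` U) : U `<=` \bigcup_i V i ->
  forall k (s t : smoothfun U k),
    (forall i, smoothfun_res (hV i) s = smoothfun_res (hV i) t) -> s = t.
Proof.
move=> UV k s t st; apply: smoothfun_eq => x /UV[i _ Vx].
have /(congr1 (fun f : smoothfun (V i) k => f x)) := st i.
by rewrite !smoothfun_resE.
Qed.

Fact smoothfun_gluing (U : openSet M) (I : Type) (V : I -> openSet M)
    (hV : forall i, V i `<=` U) : U `<=` \bigcup_i V i ->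
  forall k (s : forall i, smoothfun (V i) k),
    (forall i j (W : openSet M) (hi : W `<=` V i) (hj : W `<=` V j),
       smoothfun_res hi (s i) = smoothfun_res hj (s j)) ->
    exists t : smoothfun U k, forall i, smoothfun_res (hV i) t = s i.
Proof.
move=> UV k s Hs.
pose t x : R := xget 0 [set r | exists i, pts (V i) x /\ r = s i x].
have tE i x : pts (V i) x -> t x = s i x.
  move=> Vx; rewrite /t; case: xgetP => [r _ [j [Vjx ->]]|/(_ (s i x))]; last first.
    by case; exists i.
  have hi : openSetI (V i) (V j) `<=` V i by move=> y [].
  have hj : openSetI (V i) (V j) `<=` V j by move=> y [].
  have /(congr1 (fun f : smoothfun _ k => f x)) := Hs _ _ _ hi hj.
  by rewrite !smoothfun_resE.
have tP : t \in smoothfun_pred U k.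
  apply/asboolP; split.
  - apply: smooth_on_local => x /UV[i _ Vx]; exists (V i), (s i).
    by split=> //; [exact: ptsP|case: (smoothfunP (s i))|move=> y /tE].
  - move=> x Ux; rewrite /t; case: xgetP => // r _ [i [Vx _]].
    by case: Ux; exact: hV Vx.
  - move=> k0; apply/funext => x; rewrite /t.
    by case: xgetP => // r _ [i [Vx ->]]; rewrite (smoothfun_deg (s i)).
exists (SmoothFun tP) => i; apply: smoothfun_eq => x Vx.
by rewrite smoothfun_resE //; exact: tE.
Qed.

Definition smooth_sheaf : grSheaf M :=
  @GrSheaf M (fun U k => smoothfun U k)
    (fun U V h k => @smoothfun_res U V h k)
    smoothfun_res_id smoothfun_res_comp smoothfun_locality smoothfun_gluing.

Fact smoothfun_one_subproof (U : openSet M) :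
  cut U (fun=> 1) \in smoothfun_pred U 0.
Proof.
apply/asboolP; split => //.
- apply: smooth_on_local => x Ux; exists U, (fun=> 1); split => //.
  + exact: ptsP.
  + exact: smooth_on_cst.
  + by move=> y; exact: cutE.
- by move=> x Vx; rewrite /cut asboolF.
Qed.

Definition smoothfun_one U : smoothfun U 0 :=
  SmoothFun (smoothfun_one_subproof U).

Fact smoothfun_mul_subproof (U : openSet M) (i j k : int) (e : i + j = k)
    (f : smoothfun U i) (g : smoothfun U j) :
  (f : M -> R) * (g : M -> R) \in smoothfun_pred U k.
Proof.
have [sf zf kf] := smoothfunP f; have [sg zg kg] := smoothfunP g.
apply/asboolP; split; first exact: smooth_onM.
  by move=> x Ux; rewrite fctE zf // mul0r.
move=> k0; have [i0|i0] := eqVneq i 0; last first.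
  by rewrite (kf i0); apply/funext => x; exact: mul0r.
rewrite (kg _); first by apply/funext => x; exact: mulr0.
by apply: contra k0 => /eqP j0; rewrite -e i0 j0.
Qed.

Definition smoothfun_mul (U : openSet M) (i j k : int) (e : i + j = k)
    (f : smoothfun U i) (g : smoothfun U j) : smoothfun U k :=
  SmoothFun (smoothfun_mul_subproof e f g).

Fact smoothfun_mulDl U i j k (e : i + j = k) (a b : smoothfun U i)
    (c : smoothfun U j) :
  smoothfun_mul e (a + b) c = smoothfun_mul e a c + smoothfun_mul e b c.
Proof. by apply: val_inj; apply/funext => x; exact: mulrDl. Qed.

Fact smoothfun_mulDr U i j k (e : i + j = k) (a : smoothfun U i)
    (b c : smoothfun U j) :
  smoothfun_mul e a (b + c) = smoothfun_mul e a b + smoothfun_mul e a c.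
Proof. by apply: val_inj; apply/funext => x; exact: mulrDr. Qed.

Fact smoothfun_mulA U i j k ij jk n (eij : i + j = ij) (ejk : j + k = jk)
    (el : ij + k = n) (er : i + jk = n)
    (a : smoothfun U i) (b : smoothfun U j) (c : smoothfun U k) :
  smoothfun_mul el (smoothfun_mul eij a b) c
  = smoothfun_mul er a (smoothfun_mul ejk b c).
Proof. by apply: val_inj; apply/funext => x; rewrite /= !fctE mulrA. Qed.

Fact smoothfun_mul1 U i (e : 0 + i = i) (a : smoothfun U i) :
  smoothfun_mul e (smoothfun_one U) a = a.
Proof. by apply: smoothfun_eq => x Ux; rewrite /= fctE cutE // mul1r. Qed.

Fact smoothfun_mulC U i j k (e : i + j = k) (e' : j + i = k)
    (a : smoothfun U i) (b : smoothfun U j) :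
  smoothfun_mul e a b = smoothfun_mul e' b a *~ (-1) ^+ (`|i| * `|j|)%N.
Proof.
have mulC : smoothfun_mul e a b = smoothfun_mul e' b a.
  by apply: val_inj; apply/funext => x; exact: mulrC.
have [i0|i0] := eqVneq i 0.
  have -> : (`|i| * `|j|)%N = 0%N by rewrite i0.
  by rewrite expr0 mulr1z.
have ab0 : smoothfun_mul e a b = 0.
  rewrite (smoothfun_deg a i0); apply: val_inj; apply/funext => x.
  exact: mul0r.
by rewrite -mulC ab0 mul0rz.
Qed.

Fact smoothfun_res_one (U V : openSet M) (h : V `<=` U) :
  smoothfun_res h (smoothfun_one U) = smoothfun_one V.
Proof.
apply: smoothfun_eq => x Vx; rewrite smoothfun_resE //= !cutE //; exact: h.
Qed.

Fact smoothfun_res_mul (U V : openSet M) (h : V `<=` U) i j k (e : i + j = k)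
    (a : smoothfun U i) (b : smoothfun U j) :
  smoothfun_res h (smoothfun_mul e a b)
  = smoothfun_mul e (smoothfun_res h a) (smoothfun_res h b).
Proof.
by apply: smoothfun_eq => x Vx; rewrite smoothfun_resE //= !fctE !cutE.
Qed.

Definition smooth_functions : grRing M :=
  @GrRing M smooth_sheaf smoothfun_one smoothfun_mul smoothfun_mulDl
    smoothfun_mulDr smoothfun_mulA smoothfun_mul1 smoothfun_mulC
    smoothfun_res_one smoothfun_res_mul.

End SmoothFunctions.

Section Monomials.
Variables (T : topologicalType) (O : grRing T) (p : nat -> nat).

(* [Tagged _ (a : 'I_(p i.+1))] is the [a]-th coordinate of degree [i.+1]. *)
Definition generator := {i : nat & 'I_(p i.+1)}.

Definition gen_deg (g : generator) : int := (tag g).+1%:Z.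

Definition gen_lt (g h : generator) : bool :=
  ((tag g < tag h) || ((tag g == tag h) && (tagged g < tagged h)))%N.

(* Monomials in graded commuting variables are words in nondecreasing order,
   in which a generator of odd degree occurs at most once. *)
Definition standard (w : seq generator) : bool :=
  sorted (fun g h => gen_lt g h || (g == h) && ~~ odd (tag g).+1) w.

Definition monomial := {w : seq generator | standard w}.

Fixpoint word_deg (w : seq generator) : int :=
  if w is g :: w' then gen_deg g + word_deg w' else 0.

Variables (U : openSet T) (xi : forall g : generator, O U (gen_deg g)).

Fixpoint word_eval (w : seq generator) : O U (word_deg w) :=
  if w is g :: w' then gr_mul erefl (xi g) (word_eval w') else gr_one O U.

End Monomials.

(* [dims i] is the number of local coordinates of degree [i] for [0 < i];
   those of degree 0 are the coordinates of the smooth manifold [base].  Near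
   each point the functions are freely generated, as a graded commutative
   algebra over the smooth functions, by coordinates [xi] of positive
   degree. *)
Record nManifold (R : realType) := NManifold {
  base : smoothManifold R;
  functions :> grRing base;
  projection : grRingHom (smooth_functions base) functions;
  projection_bij : forall U, bijective (projection U 0);
  dims : nat -> nat;
  local_coordinates : forall x : base, exists U : openSet base, pts U x /\
      exists xi : forall g : generator dims, functions U (gen_deg g),
        homogeneous_frame (F := as_module projection)
          (fun w : monomial dims => word_eval xi (val w)) }.

Section ZeroEmbedding.
Variables (R : realType) (N : nManifold R).

Lemma word_deg_ge0 (p : nat -> nat) (w : seq (generator p)) : 0 <= word_deg w.
Proof. by elim: w => //= g w IH; rewrite addr_ge0. Qed.

Lemma functions_lt0 U k (f : N U k) : k < 0 -> f = 0.
Proof.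
move=> k0.
pose I := {W : openSet (base N) & {h : W `<=` U | res N h k f = 0}}.
have hI (i : I) : tag i `<=` U := sval (tagged i).
apply: (sheaf_locality (V := fun i : I => tag i) (hV := hI)).
  move=> x Ux; have [V [Vx [xi [_ span]]]] := local_coordinates x.
  have hV : openSetI U V `<=` V by move=> y [].
  have hU : openSetI U V `<=` U by move=> y [].
  have [W [hW [s [c [Wx fE]]]]] :=
    span (openSetI U V) hV k (res N hU k f) x (conj Ux Vx).
  have hWU := subset_trans hW hU.
  have f0 : res N hWU k f = 0.
    rewrite -(res_comp hU hW) fE /combination big1 // => w _.
    rewrite [c w]smoothfun_deg; first by rewrite /= /scal raddf0; exact: gr_mul0l.
    by rewrite lt_eqF // subr_lt0 (lt_le_trans k0) ?word_deg_ge0.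
  by exists (existT _ W (exist _ hWU f0)).
move=> i; rewrite raddf0; case: i (hI i) => W [h fh] /= h'.
by rewrite (Prop_irrelevance h' h).
Qed.

(* Functions of positive degree are annihilated, as are those of negative
   degree (there are none). *)
Definition zero_fun U k (f : N U k) : smoothfun U k :=
  xget 0 [set g : smoothfun U k | projection N U k g = f].

Lemma projection_inj U : injective (projection N U 0).
Proof. exact: bij_inj (projection_bij _). Qed.

Lemma zero_fun_deg U k (f : N U k) : k != 0 -> zero_fun f = 0.
Proof. exact: smoothfun_deg. Qed.

Lemma projectionK U (f : N U 0) : projection N U 0 (zero_fun f) = f.
Proof.
have [h _ hK] := @projection_bij _ N U.
by rewrite /zero_fun; case: xgetP => [g _ //|/(_ (h f))]; rewrite /= hK.
Qed.

Lemma zero_funK U k (g : smoothfun U k) : zero_fun (projection N U k g) = g.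
Proof.
have [k0|k0] := eqVneq k 0; last exact: smoothfun_deg_eq.
by subst k; apply: projection_inj; exact: projectionK.
Qed.

Fact zero_fun_additive U k : zmod_morphism (@zero_fun U k).
Proof.
move=> f g; have [k0|k0] := eqVneq k 0; last exact: smoothfun_deg_eq.
by subst k; apply: projection_inj; rewrite raddfB !projectionK.
Qed.
HB.instance Definition _ U k :=
  GRing.isZmodMorphism.Build (N U k) (smoothfun U k) (@zero_fun U k)
    (@zero_fun_additive U k).

Fact zero_fun_res (U V : openSet (base N)) (h : V `<=` U) k (s : N U k) :
  zero_fun (res N h k s) = res (smooth_functions (base N)) h k (zero_fun s).
Proof.
have [k0|k0] := eqVneq k 0; last exact: smoothfun_deg_eq.
by subst k; apply: projection_inj; rewrite hom_res !projectionK.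
Qed.

Definition zero_hom : grHom N (smooth_functions (base N)) :=
  @GrHom _ N (smooth_functions (base N)) (fun U k => @zero_fun U k)
    zero_fun_res.

Fact zero_fun1 U : zero_hom U 0 (gr_one N U) = gr_one _ U.
Proof. by apply: projection_inj; rewrite projectionK ring_hom1. Qed.

Fact zero_funM U i j k (e : i + j = k) (a : N U i) (b : N U j) :
  zero_hom U k (gr_mul e a b) = gr_mul e (zero_hom U i a) (zero_hom U j b).
Proof.
have [k0|k0] := eqVneq k 0; last exact: smoothfun_deg_eq.
have [i0|i0] := eqVneq i 0.
  have j0 : j = 0 by rewrite -k0 -e i0 add0r.
  by subst i j k; apply: projection_inj; rewrite ring_homM !projectionK.
rewrite [zero_hom U i a](smoothfun_deg _ i0) gr_mul0l.
suff -> : gr_mul e a b = 0 by rewrite raddf0.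
have [i_lt0|i_gt0|/eqP] := ltgtP i 0; last by rewrite (negbTE i0).
  by rewrite (functions_lt0 a i_lt0) gr_mul0l.
rewrite (functions_lt0 b) ?gr_mul0r //.
by rewrite -(ltrD2l i) e k0 addr0.
Qed.

Definition zero_embedding : grRingHom N (smooth_functions (base N)) :=
  GrRingHom zero_fun1 zero_funM.

End ZeroEmbedding.

(* Main.v *)
From HB Require Import structures.
Require Import Defs.
From mathcomp Require Import all_boot all_order all_algebra.
From mathcomp Require Import all_classical all_reals all_analysis.
From mathcomp Require Import ring.

(* Write O0 for the smooth functions on M and O for the functions on the
   N-manifold.  A local frame e_j of B gives the local frame rho(e_j) of E, so
   rho : B -> E has local O0-linear sections; bump functions glue them to a
   global section sig : E -> B.  If T_n are O0-linear maps E -> B with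
   rho T_n = id on V_n and the V_n cover M, then the maps S_0 = 0 and
   S_(n+1) = S_n + T_n (id - rho S_n) satisfy rho S_m = id on V_n, hence
   S_(m+1) = S_m there, for m > n, so that no partition of unity is needed.
   The section sig induces an O-linear map g : pi^* E -> B.  Locally,
   e_j - sig (rho e_j) lies in the kernel of rho, so it is a combination of
   frame elements of degree < deg e_j; as the degrees are bounded,
   e_j |-> sig (rho e_j) is the identity minus a nilpotent map, hence
   invertible, and so is g. *)

Set Implicit Arguments.
Unset Strict Implicit.
Unset Printing Implicit Defensive.

Import Order.TTheory GRing.Theory Num.Theory.
Import numFieldNormedType.Exports.

Local Open Scope classical_set_scope.
Local Open Scope ring_scope.

(** * Graded sheaves, modules and homomorphisms *)

Definition full (T : topologicalType) : openSet T := OpenSet openT.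
Arguments full {T}.

Lemma sub_full (T : topologicalType) (U : openSet T) : U `<=` (full : openSet T).
Proof. by []. Qed.

Section Sheaves.
Variables (T : topologicalType) (F : grSheaf T).

Definition glob_res (W : openSet T) k (s : F full k) : F W k :=
  res F (@sub_full T W) k s.

Lemma res_irr (U V : openSet T) (h h' : V `<=` U) k (s : F U k) :
  res F h k s = res F h' k s.
Proof. by rewrite (Prop_irrelevance h h'). Qed.

Lemma res_res (U V W : openSet T) (h : V `<=` U) (h' : W `<=` V) k (s : F U k) :
  res F h' k (res F h k s) = res F (subset_trans h' h) k s.
Proof. exact: res_comp. Qed.

Lemma res_glob (U V : openSet T) (h : V `<=` U) k (s : F full k) :
  res F h k (glob_res U s) = glob_res V s.
Proof. by rewrite /glob_res res_res; exact: res_irr. Qed.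

Lemma section_eq (U : openSet T) k (s t : F U k) :
  (forall x, pts U x -> exists (W : openSet T) (h : W `<=` U),
      pts W x /\ res F h k s = res F h k t) -> s = t.
Proof.
move=> H.
pose I := {W : openSet T & {h : W `<=` U | res F h k s = res F h k t}}.
apply: (sheaf_locality (V := fun i : I => tag i)
         (hV := fun i => sval (tagged i))).
  by move=> x /H [W [h [Wx e]]]; exists (existT _ W (exist _ h e)).
by move=> [W [h e]].
Qed.

(** The cover is indexed by all pairs of an open set and a section satisfying [Q]. No local sections
    have to be chosen, and the glued section is known on every subset of [U] where [Q] prescribes
    one. *)
Lemma glue_rel (U : openSet T) k (Q : forall W : openSet T, F W k -> Prop) :
  (forall x, pts U x -> exists (W : openSet T) (s : F W k),
      [/\ W `<=` U, pts W x & Q W s]) ->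
  (forall (W1 W2 W : openSet T) (h1 : W `<=` W1) (h2 : W `<=` W2)
      (s1 : F W1 k) (s2 : F W2 k),
      W1 `<=` U -> W2 `<=` U -> Q W1 s1 -> Q W2 s2 ->
      res F h1 k s1 = res F h2 k s2) ->
  exists t : F U k, forall (W : openSet T) (h : W `<=` U) (s : F W k),
    Q W s -> res F h k t = s.
Proof.
move=> ex un.
pose I := {W : openSet T & {s : F W k | W `<=` U /\ Q W s}}.
have [||t Ht] := @sheaf_gluing T F U I (fun i => tag i)
    (fun i => (svalP (tagged i)).1) _ k (fun i => sval (tagged i)).
- by move=> x /ex [W [s [h Wx q]]]; exists (existT _ W (exist _ s (conj h q))).
- move=> [W1 [s1 [k1 q1]]] [W2 [s2 [k2 q2]]] W /= h1 h2; exact: un.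
exists t => W h s q.
have := Ht (existT _ W (exist _ s (conj h q))) => /= <-.
exact: res_irr.
Qed.

End Sheaves.

Section Shift.
Variables (T : topologicalType) (O : grRing T) (d : int).

(** The coordinate of a section of degree [k] along a frame element of degree [d] has degree
    [k - d]. The shift turns such coordinates into degree-preserving homomorphisms, to which the
    universal property of a pullback applies. *)
Definition shift_sheaf : grSheaf T.
Proof.
refine (@GrSheaf T (fun U k => O U (k - d))
  (fun U V h k => res O h (k - d)) _ _ _ _).
- by move=> *; exact: res_id.
- by move=> *; exact: res_comp.
- by move=> U I V hV UV k s t; exact: sheaf_locality.
- by move=> U I V hV UV k s; exact: sheaf_gluing.
Defined.

Fact shift_deg (i j k : int) : i + j = k -> i + (j - d) = k - d.
Proof. by move=> <-; rewrite addrA. Qed.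

(** No sign appears, because coefficients stand to the left of frame elements. *)
Definition shift_act U (i j k : int) (e : i + j = k) (a : O U i)
  (s : shift_sheaf U j) : shift_sheaf U k := gr_mul (shift_deg e) a s.

Definition degree_shift : grModule O.
Proof.
refine (@GrModule T O shift_sheaf shift_act _ _ _ _ _).
- by move=> *; exact: gr_mulDl.
- by move=> *; exact: gr_mulDr.
- by move=> *; exact: gr_mulA.
- by move=> *; exact: gr_mul1.
- by move=> *; exact: res_mul.
Defined.

End Shift.

(** Viewing [O] as a module over itself lets the lemmas about [act] serve for products. *)
Definition regular (T : topologicalType) (O : grRing T) : grModule O :=
  GrModule (@gr_mulDl T O) (@gr_mulDr T O) (@gr_mulA T O) (@gr_mul1 T O)
    (@res_mul T O).

Section Modules.
Variables (T : topologicalType) (O : grRing T) (F : grModule O).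

Lemma act0l U i j k (e : i + j = k) (s : F U j) : act e (0 : O U i) s = 0.
Proof. by apply: (addrI (act e 0 s)); rewrite -actDl !addr0. Qed.

Lemma act0r U i j k (e : i + j = k) (a : O U i) : act e a (0 : F U j) = 0.
Proof. by apply: (addrI (act e a 0)); rewrite -actDr !addr0. Qed.

Lemma actNr U i j k (e : i + j = k) (a : O U i) (s : F U j) :
  act e a (- s) = - act e a s.
Proof. by apply: (addrI (act e a s)); rewrite -actDr !subrr act0r. Qed.

Lemma actNl U i j k (e : i + j = k) (a : O U i) (s : F U j) :
  act e (- a) s = - act e a s.
Proof. by apply: (addrI (act e a s)); rewrite -actDl !subrr act0l. Qed.

Lemma actBr U i j k (e : i + j = k) (a : O U i) (s t : F U j) :
  act e a (s - t) = act e a s - act e a t.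
Proof. by rewrite actDr actNr. Qed.

Lemma actBl U i j k (e : i + j = k) (a b : O U i) (s : F U j) :
  act e (a - b) s = act e a s - act e b s.
Proof. by rewrite actDl actNl. Qed.

Lemma act_sumr (I : Type) (r : seq I) U i j k (e : i + j = k) (a : O U i)
    (s : I -> F U j) :
  act e a (\sum_(x <- r) s x) = \sum_(x <- r) act e a (s x).
Proof.
elim: r => [|x r IH]; first by rewrite !big_nil act0r.
by rewrite !big_cons actDr IH.
Qed.

Lemma actMnl U i j k (e : i + j = k) (a : O U i) (s : F U j) n :
  act e (a *+ n) s = act e a s *+ n.
Proof.
elim: n => [|n IH]; first by rewrite !mulr0n act0l.
by rewrite !mulrS actDl IH.
Qed.

Lemma gr_mulC0 U i (e : 0 + i = i) (e' : i + 0 = i) (a : O U 0) (b : O U i) :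
  gr_mul e a b = gr_mul e' b a.
Proof. by rewrite (gr_mulC _ e') mul0n expr0 mulr1z. Qed.

(** Commuting past a function of degree 0 produces no sign. Hence multiplication by a bump function
    is linear over all of [O]. *)
Lemma act_central U i j k (e : i + j = k) (a : O U 0) (b : O U i) (s : F U j) :
  act (add0r k) a (act e b s) = act e b (act (add0r j) a s).
Proof.
have e' : 0 + i = i by rewrite add0r.
have e'' : i + 0 = i by rewrite addr0.
by rewrite -(actA e' e e (add0r k)) (gr_mulC0 _ e'') (actA e'' (add0r j) e e).
Qed.

End Modules.

Section Homs.
Variable T : topologicalType.
Implicit Types F G H : grSheaf T.

Definition MkHom F G (f : forall U k, F U k -> G U k)
    (fB : forall U k, zmod_morphism (f U k))
    (fres : forall (U V : openSet T) (h : V `<=` U) k (s : F U k),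
       f V k (res F h k s) = res G h k (f U k s)) : grHom F G :=
  @GrHom T F G (fun U k => HB.pack (f U k)
     (GRing.isZmodMorphism.Build _ _ (f U k) (fB U k))) fres.

(* [semilinear phi] and [grlinear] are the instances [slin phi] and [slin id];
   an arbitrary family of functions is allowed so that composites need no
   composition of ring homomorphisms. *)
Definition slin (O O' : grRing T) (phi : forall U i, O U i -> O' U i)
    (F : grModule O) (G : grModule O') (h : grHom F G) : Prop :=
  forall U i j k (e : i + j = k) (a : O U i) (s : F U j),
    h U k (act e a s) = act e (phi U i a) (h U j s).

Definition id_hom F : grHom F F.
Proof. by refine (@MkHom F F (fun U k s => s) _ _). Defined.

Definition comp_hom F G H (g : grHom G H) (f : grHom F G) : grHom F H.
Proof.
refine (@MkHom F H (fun U k s => g U k (f U k s)) _ _).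
- by move=> U k s t; rewrite !raddfB.
- by move=> U V h k s; rewrite !hom_res.
Defined.

Definition zero_map F G : grHom F G.
Proof.
refine (@MkHom F G (fun U k s => 0) _ _).
- by move=> U k s t; rewrite subrr.
- by move=> U V h k s; rewrite raddf0.
Defined.

Definition add_hom F G (f g : grHom F G) : grHom F G.
Proof.
refine (@MkHom F G (fun U k s => f U k s + g U k s) _ _).
- by move=> U k s t; rewrite !raddfB opprD addrACA.
- by move=> U V h k s; rewrite !hom_res raddfD.
Defined.

Definition sub_hom F G (f g : grHom F G) : grHom F G.
Proof.
refine (@MkHom F G (fun U k s => f U k s - g U k s) _ _).
- by move=> U k s t; rewrite !raddfB /= addrACA.
- by move=> U V h k s; rewrite !hom_res raddfB.
Defined.

End Homs.

Section Scale.
Variables (T : topologicalType) (O : grRing T) (F : grModule O) (a : O full 0).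

Definition scale_hom : grHom F F.
Proof.
refine (@MkHom T F F (fun U k s => act (add0r k) (glob_res U a) s) _ _).
- by move=> U k s t; rewrite actBr.
- by move=> U V h k s; rewrite res_act res_glob.
Defined.

Lemma scale_hom_slin : grlinear scale_hom.
Proof. by move=> U i j k e b s /=; rewrite act_central. Qed.

End Scale.

Section Lincomb.
Variables (T : topologicalType) (O : grRing T) (F : grModule O).
Variables (J : Type) (js : seq J) (d : J -> int) (e : forall j, F full (d j)).

(** In contrast to [combination], the elements [e j] are global, so that [lincomb_hom] is defined
    over the whole space. *)
Definition lincomb W k (a : forall j, O W (k - d j)) : F W k :=
  \sum_(j <- js) act (subrK (d j) k) (a j) (glob_res W (e j)).

Lemma eq_lincomb W k (a b : forall j, O W (k - d j)) :
  (forall j, a j = b j) -> lincomb a = lincomb b.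
Proof. by move=> ab; apply: eq_bigr => j _; rewrite ab. Qed.

Lemma res_lincomb (W W' : openSet T) (h : W' `<=` W) k
    (a : forall j, O W (k - d j)) :
  res F h k (lincomb a) = lincomb (fun j => res O h _ (a j)).
Proof.
rewrite /lincomb raddf_sum; apply: eq_bigr => j _.
by rewrite res_act res_glob.
Qed.

Lemma lincombB W k (a b : forall j, O W (k - d j)) :
  lincomb (fun j => a j - b j) = lincomb a - lincomb b.
Proof.
by rewrite /lincomb -sumrB; apply: eq_bigr => j _; rewrite actBl.
Qed.

Lemma act_lincomb W i j k (ee : i + j = k) (a : O W i)
    (c : forall x, O W (j - d x)) :
  act ee a (lincomb c) = lincomb (fun x => gr_mul (shift_deg (d x) ee) a (c x)).
Proof.
rewrite /lincomb act_sumr; apply: eq_bigr => x _.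
by rewrite (actA _ (subrK (d x) j) _ ee).
Qed.

Variables (O0 : grRing T) (phi : forall U i, O0 U i -> O U i).
Variables (A : grModule O0) (c : forall j, grHom A (degree_shift O (d j))).
Hypothesis c_lin : forall j, slin phi (c j).

Definition lincomb_hom : grHom A F.
Proof.
refine (@MkHom T A F (fun U k s => lincomb (fun j => c j U k s)) _ _).
- by move=> U k s t; rewrite -lincombB; apply: eq_lincomb => j; rewrite raddfB.
- move=> U V h k s; rewrite res_lincomb; apply: eq_lincomb => j.
  by rewrite hom_res.
Defined.

Lemma lincomb_hom_slin : slin phi lincomb_hom.
Proof.
move=> U i j k ee a s /=; rewrite act_lincomb; apply: eq_lincomb => x.
by rewrite c_lin.
Qed.

End Lincomb.

Lemma slin_lincomb (T : topologicalType) (O O' : grRing T)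
    (phi : forall U i, O U i -> O' U i) (F : grModule O) (G : grModule O')
    (h : grHom F G) (hl : slin phi h) (J : Type) (js : seq J) (d : J -> int)
    (e : forall j, F full (d j)) W k (a : forall j, O W (k - d j)) :
  h W k (lincomb js e a)
  = lincomb js (fun j => h full _ (e j)) (fun j => phi W _ (a j)).
Proof.
rewrite /lincomb raddf_sum; apply: eq_bigr => j _.
by rewrite hl /glob_res hom_res.
Qed.

Section ShiftHom.
Variables (T : topologicalType) (O O' : grRing T) (phi : grRingHom O O') (d : int).

Definition shift_hom : grHom (degree_shift O d) (degree_shift O' d).
Proof.
refine (@MkHom T (degree_shift O d) (degree_shift O' d)
  (fun U k s => phi U (k - d) s) _ _).
- by move=> U k s t; rewrite raddfB.
- by move=> U V h k s; exact: (hom_res phi).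
Defined.

Lemma shift_hom_slin : slin (fun U i => phi U i) shift_hom.
Proof. by move=> U i j k ee a s; exact: ring_homM. Qed.

End ShiftHom.

(** * Bump functions and dual frames *)

(** The support condition is expressed by an open [Z] that covers the space together with [U]. Using
    only restriction, 0 and 1, the notion makes sense for any [O] and passes along ring
    homomorphisms. *)
Definition is_bump (T : topologicalType) (O : grRing T) (U V : openSet T)
    (chi : O full 0) : Prop :=
  [/\ V `<=` U, glob_res V chi = gr_one O V &
      exists Z : openSet T,
        (forall x, pts U x \/ pts Z x) /\ glob_res Z chi = 0].

Definition has_bumps (T : topologicalType) (O : grRing T) : Prop :=
  forall (U : openSet T) x, pts U x ->
    exists (V : openSet T) (chi : O full 0), pts V x /\ is_bump U V chi.

Definition eq_on (T : topologicalType) (F G : grSheaf T) (V : openSet T)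
    (f g : grHom F G) : Prop :=
  forall (W : openSet T), W `<=` V -> forall k (s : F W k), f W k s = g W k s.

Section Bump.
Variables (T : topologicalType) (O : grRing T) (U V : openSet T).
Variables (chi : O full 0) (F : grModule O).
Hypothesis chiP : is_bump U V chi.

Lemma bump1 (W : openSet T) k (s : F W k) : W `<=` V ->
  act (add0r k) (glob_res W chi) s = s.
Proof.
case: chiP => _ c1 _ h.
by rewrite -(res_glob h) c1 res_one act1.
Qed.

(** Inside [U] the two homomorphisms agree, and inside [Z] the factor [chi] vanishes. *)
Lemma eq_on_bump (A : grSheaf T) (f g : grHom A F) :
  eq_on U f g -> forall (W : openSet T) k (s : A W k),
  act (add0r k) (glob_res W chi) (f W k s) =
  act (add0r k) (glob_res W chi) (g W k s).
Proof.
move=> fg W k s; case: chiP => _ _ [Z [UZ chi0]].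
apply: section_eq => x Wx; case: (UZ x) => [Ux|Zx].
  have hW : openSetI W U `<=` W by move=> y [].
  have hU : openSetI W U `<=` U by move=> y [].
  exists (openSetI W U), hW; split=> //.
  by rewrite !res_act -!hom_res fg.
have hW : openSetI W Z `<=` W by move=> y [].
have hZ : openSetI W Z `<=` Z by move=> y [].
exists (openSetI W Z), hW; split=> //.
rewrite !res_act res_glob -(res_glob hZ) chi0 raddf0.
by rewrite !act0l.
Qed.

(** The product of [chi] and [s] extends by zero across [Z], and it equals [s] on [V], where [chi]
    is 1. *)
Lemma bump_extend k (s : F U k) : exists t : F full k,
  forall (W : openSet T) (h : W `<=` V) (hU : W `<=` U),
    glob_res W t = res F hU k s.
Proof.
case: chiP => VU c1 [Z [UZ chi0]].
pose Q (W : openSet T) (t : F W k) :=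
  (exists h : W `<=` U, t = act (add0r k) (glob_res W chi) (res F h k s)) \/
  (W `<=` Z /\ t = 0).
have hUU : U `<=` U by [].
have [||t Ht] := @glue_rel T F full k Q.
- move=> x _; case: (UZ x) => [Ux|Zx].
    exists U; eexists; split=> //; left; exists hUU; reflexivity.
  by exists Z, 0; split; [|exact: Zx|right; split].
- have chiZ (W : openSet T) : W `<=` Z -> glob_res W chi = 0.
    by move=> h; rewrite -(res_glob h) chi0 raddf0.
  move=> W1 W2 W h1 h2 s1 s2 _ _ [[k1 ->]|[k1 ->]] [[k2 ->]|[k2 ->]];
    rewrite ?res_act ?res_glob ?raddf0 ?res_res //.
  + by congr act; exact: res_irr.
  + by rewrite chiZ ?act0l //; exact: (subset_trans h2 k2).
  + by rewrite chiZ ?act0l //; exact: (subset_trans h1 k1).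
exists t => W h hU.
have hW : W `<=` (full : openSet T) by [].
rewrite /glob_res (res_irr _ hW).
rewrite (Ht _ hW (act (add0r k) (glob_res W chi) (res F hU k s))) ?bump1 //.
by left; exists hU; rewrite bump1.
Qed.

End Bump.

(** Elements and coordinates live over the whole space although duality is required only over [V]:
    the universal property in [is_pullback] concerns homomorphisms of whole sheaves and cannot be
    applied to data on an open subset. *)
Definition dual_frame (T : topologicalType) (O : grRing T) (F : grModule O)
    (V : openSet T) (J : Type) (js : seq J) (d : J -> int)
    (e : forall j, F full (d j)) (c : forall j, grHom F (degree_shift O (d j))) : Prop :=
  [/\ forall j, grlinear (c j),
      forall W : openSet T, W `<=` V -> forall k (s : F W k),
        s = lincomb js e (fun j => c j W k s) &
      forall W : openSet T, W `<=` V -> forall k (a : forall j, O W (k - d j)) j,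
        c j W k (lincomb js e a) = a j].

Section Frames.
Variables (T : topologicalType) (O : grRing T) (F : grModule O).
Variables (U : openSet T) (J : eqType) (dg : J -> int).
Variable e : forall j, F U (dg j).
Hypothesis eP : homogeneous_frame e.
Variable js : seq J.
Hypothesis js_uniq : uniq js.
Hypothesis js_all : forall j, j \in js.

Let comb (W : openSet T) (h : W `<=` U) k (c : forall j, O W (k - dg j)) : F W k :=
  combination e h js c.

Lemma combinationB (W : openSet T) (h : W `<=` U) k (a b : forall j, O W (k - dg j)) :
  comb h (fun j => a j - b j) = comb h a - comb h b.
Proof. by rewrite /comb /combination -sumrB; apply: eq_bigr => j _; rewrite actBl. Qed.

Lemma act_combination (W : openSet T) (h : W `<=` U) i j k (ee : i + j = k) (a : O W i)
    (c : forall x, O W (j - dg x)) :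
  act ee a (comb h c) = comb h (fun x => gr_mul (shift_deg (dg x) ee) a (c x)).
Proof.
rewrite /comb /combination act_sumr; apply: eq_bigr => x _.
by rewrite (actA _ (subrK (dg x) j) _ ee).
Qed.

Lemma res_combination (W : openSet T) (h : W `<=` U)
    (W' : openSet T) (h' : W' `<=` W) (hU : W' `<=` U) k
    (c : forall x, O W (k - dg x)) :
  res F h' k (comb h c) = comb hU (fun x => res O h' _ (c x)).
Proof.
rewrite /comb /combination raddf_sum; apply: eq_bigr => x _.
by rewrite res_act res_res; congr act; exact: res_irr.
Qed.

Lemma comb_inj (W : openSet T) (h h' : W `<=` U) k (a b : forall j, O W (k - dg j)) :
  comb h a = comb h' b -> forall j, a j = b j.
Proof.
rewrite (Prop_irrelevance h' h) => ab j; apply/eqP; rewrite -subr_eq0; apply/eqP.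
apply: (eP.1 W h k js (fun j => a j - b j)) => //.
by rewrite -/(comb _ _) combinationB ab subrr.
Qed.

Lemma comb_local (W : openSet T) (h : W `<=` U) k (f : F W k) x : pts W x ->
  exists (W' : openSet T) (h' : W' `<=` W) (hU : W' `<=` U) c,
    pts W' x /\ res F h' k f = comb hU c.
Proof.
move=> Wx; have [W' [h' [s [c [W'x E]]]]] := eP.2 W h k f x Wx.
(* The list [s] may omit or repeat indices; weighting by multiplicity rewrites the sum over [s] as a
   sum over [js]. *)
exists W', h', (subset_trans h' h), (fun j => c j *+ count_mem j s).
split=> //; rewrite E {E}.
rewrite /combination /comb /combination.
under [in RHS]eq_bigr do rewrite actMnl.
elim: s => [|y s IH]; first by rewrite big_nil big1.
rewrite big_cons IH.
under [in RHS]eq_bigr do rewrite /= mulrnDr.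
rewrite big_split /=; congr (_ + _).
rewrite (bigD1_seq y) //= eqxx mulr1n big1 ?addr0 // => j jy.
by rewrite eq_sym (negbTE jy) mulr0n.
Qed.

Variables (V : openSet T) (chi : O full 0).
Hypothesis chiP : is_bump U V chi.

(** Genuine coordinates exist only inside [U]; multiplied by [chi] they can be extended by zero. *)
Definition cut_coord (W : openSet T) k (f : F W k) j (t : O W (k - dg j)) : Prop :=
  forall (W' : openSet T) (h : W' `<=` W) (hU : W' `<=` U) c,
    res F h k f = comb hU c ->
    res O h _ t = gr_mul (add0r _) (glob_res W' chi) (c j).

(** Independence of the frame makes the local products glue. The second clause fixes the section off
    [U], where [cut_coord] says nothing. *)
Lemma cut_coordP (W : openSet T) k (f : F W k) j :
  exists t : O W (k - dg j), cut_coord f t /\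
    forall (W' : openSet T) (h : W' `<=` W), glob_res W' chi = 0 -> res O h _ t = 0.
Proof.
case: chiP => VU c1 [Z [UZ chi0]].
pose Q (W' : openSet T) (t : O W' (k - dg j)) :=
  (exists (h : W' `<=` W) (hU : W' `<=` U) c, res F h k f = comb hU c /\
     t = gr_mul (add0r _) (glob_res W' chi) (c j)) \/
  (glob_res W' chi = 0 /\ t = 0).
have [||t Ht] := @glue_rel T O W (k - dg j) Q.
- move=> x Wx; case: (UZ x) => [Ux|Zx].
    have hW : openSetI W U `<=` W by move=> y [].
    have hU : openSetI W U `<=` U by move=> y [].
    have [W' [h' [hU' [c [W'x E]]]]] :=
      comb_local hU (res F hW k f) (conj Wx Ux).
    exists W'; eexists; split; [|exact: W'x|]; first exact: (subset_trans h' hW).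
    by left; exists (subset_trans h' hW), hU', c; split; first rewrite -E res_res.
  have hW : openSetI W Z `<=` W by move=> y [].
  have hZ : openSetI W Z `<=` Z by move=> y [].
  exists (openSetI W Z), 0; split=> //; right; split=> //.
  by rewrite -(res_glob hZ) chi0 raddf0.
- have chiZ (W1 W2 : openSet T) : W1 `<=` W2 -> glob_res W2 chi = 0 ->
      glob_res W1 chi = 0.
    by move=> h e0; rewrite -(res_glob h) e0 raddf0.
  move=> W1 W2 W3 h1 h2 s1 s2 k1 k2
    [[g1 [u1 [a1 [E1 ->]]]]|[z1 ->]] [[g2 [u2 [a2 [E2 ->]]]]|[z2 ->]];
    rewrite ?res_mul ?res_glob ?raddf0 //.
  + congr gr_mul.
    have u3 := subset_trans h1 u1.
    have := congr1 (res F h1 k) E1; have := congr1 (res F h2 k) E2.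
    rewrite !res_res !(res_combination _ _ u3) => E2'.
    by rewrite (res_irr _ (subset_trans h2 g2)) E2' => /comb_inj ->.
  + by rewrite (chiZ _ _ h2 z2) gr_mul0l.
  + by rewrite (chiZ _ _ h1 z1) gr_mul0l.
exists t; split.
  by move=> W' h hU c E; apply: Ht; left; exists h, hU, c.
by move=> W' h z; apply: Ht; right.
Qed.

Definition coord j (W : openSet T) k (f : F W k) : O W (k - dg j) :=
  projT1 (cid (cut_coordP f j)).

Lemma coordP j (W : openSet T) k (f : F W k) : cut_coord f (coord j f).
Proof. by rewrite /coord; case: cid => t []. Qed.

Lemma coord0 j (W : openSet T) k (f : F W k) (W' : openSet T)
    (h : W' `<=` W) : glob_res W' chi = 0 ->
  res O h _ (coord j f) = 0.
Proof. by rewrite /coord; case: cid => t [_] /= H; exact: H. Qed.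

(* Coordinates of sums, multiples and restrictions are only known where the
   given sections have coordinates, hence the passage to smaller open sets. *)
Lemma coord_unique j (W : openSet T) k (f : F W k) (t : O W (k - dg j)) :
  (forall (W' : openSet T) (h : W' `<=` W), glob_res W' chi = 0 -> res O h _ t = 0) ->
  (forall x, pts W x -> pts U x ->
     exists (W' : openSet T) (h : W' `<=` W) (hU : W' `<=` U) c,
     [/\ pts W' x, res F h k f = comb hU c &
         res O h _ t = gr_mul (add0r _) (glob_res W' chi) (c j)]) ->
  coord j f = t.
Proof.
move=> t0 tU; case: chiP => VU c1 [Z [UZ chi0]].
apply: section_eq => x Wx; case: (UZ x) => [Ux|Zx].
  have [W' [h [hU [c [W'x E E']]]]] := tU x Wx Ux.
  exists W', h; split=> //.
  by rewrite E'; apply: coordP E.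
have hW : openSetI W Z `<=` W by move=> y [].
have hZ : openSetI W Z `<=` Z by move=> y [].
exists (openSetI W Z), hW; split=> //.
by rewrite t0 ?coord0 // -(res_glob hZ) chi0 raddf0.
Qed.

Lemma comb_at (W : openSet T) k (f : F W k) x : pts W x -> pts U x ->
  exists (W' : openSet T) (h : W' `<=` W) (hU : W' `<=` U) c,
    pts W' x /\ res F h k f = comb hU c.
Proof.
move=> Wx Ux.
have hW : openSetI W U `<=` W by move=> y [].
have hU : openSetI W U `<=` U by move=> y [].
have [W' [h' [hU' [c [W'x E]]]]] := comb_local hU (res F hW k f) (conj Wx Ux).
by exists W', (subset_trans h' hW), hU', c; rewrite -E res_res.
Qed.

Definition coord_hom j : grHom F (degree_shift O (dg j)).
Proof.
refine (@MkHom T F (degree_shift O (dg j)) (fun W k f => coord j f) _ _).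
- move=> W k f g; apply: coord_unique.
    by move=> W' h z; rewrite raddfB !coord0 // subrr.
  move=> x Wx Ux.
  have [W1 [h1 [u1 [a1 [W1x E1]]]]] := comb_at f Wx Ux.
  have U1x := u1 _ W1x.
  have [W2 [h2 [u2 [a2 [W2x E2]]]]] := comb_at (res F h1 k g) W1x U1x.
  have hW := subset_trans h2 h1.
  have E1' : res F hW k f = comb u2 (fun j => res O h2 _ (a1 j)).
    by rewrite -(res_combination u1) -E1 res_res; exact: res_irr.
  have E2' : res F hW k g = comb u2 a2 by rewrite -E2 res_res; exact: res_irr.
  exists W2, hW, u2, (fun j => res O h2 _ (a1 j) - a2 j); split=> //.
    by rewrite combinationB raddfB E1' E2'.
  rewrite raddfB (coordP j E1') (coordP j E2').
  exact/esym/(actBr (F := regular O)).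
- move=> W W' h k f; apply: coord_unique.
    move=> W'' h' z; rewrite res_res coord0 //.
  move=> x Wx Ux.
  have [W1 [h1 [u1 [a1 [W1x E1]]]]] := comb_at (res F h k f) Wx Ux.
  exists W1, h1, u1, a1; split=> //.
  by rewrite res_res (@coordP j _ _ f _ _ u1 a1) // -E1 res_res.
Defined.

Lemma coord_hom_lin j : grlinear (coord_hom j).
Proof.
move=> W p q k ee a f /=; apply: coord_unique.
  by move=> W' h z; rewrite res_mul coord0 // gr_mul0r.
move=> x Wx Ux.
have [W' [h [hU [c [W'x E]]]]] := comb_at f Wx Ux.
exists W', h, hU, (fun x => gr_mul (shift_deg (dg x) ee) (res O h _ a) (c x)).
split=> //; first by rewrite res_act E act_combination.
rewrite res_mul (coordP j E).
exact/esym/(act_central (F := regular O) _ _ _ (c j)).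
Qed.

(** The frame elements are extended by [bump_extend] and the coordinates are multiplied by [chi];
    over [V] neither operation changes anything. *)
Lemma frame_dual : exists (e' : forall j, F full (dg j))
  (c : forall j, grHom F (degree_shift O (dg j))), dual_frame V js e' c.
Proof.
have VU : V `<=` U by case: chiP.
have H : forall j, exists t : F full (dg j),
    forall (W : openSet T) (h : W `<=` V) (hU : W `<=` U),
      glob_res W t = res F hU (dg j) (e j).
  by move=> j; apply: bump_extend chiP _ _.
pose e' j := projT1 (cid (H j)); have e'P j := projT2 (cid (H j)).
exists e', coord_hom.
have lincombE (W : openSet T) (h : W `<=` V) k (a : forall j, O W (k - dg j)) :
    lincomb js e' a = comb (subset_trans h VU) a.
  by apply: eq_bigr => j _; rewrite (e'P _ _ h (subset_trans h VU)).
split=> [j|W h k s|W h k a j]; first exact: coord_hom_lin.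
  apply: section_eq => x Wx.
  have [W' [h' [hU [c [W'x E]]]]] := comb_at s Wx (VU _ (h _ Wx)).
  exists W', h'; split=> //; rewrite lincombE (res_combination _ _ hU) E.
  apply: eq_bigr => j _; congr act.
  rewrite /= (coordP j E); apply/esym/(bump1 (F := regular O) chiP).
  exact: subset_trans h.
(* A trivial restriction is inserted because [coordP] describes coordinates only through their
   restrictions. *)
rewrite /= lincombE -[LHS](@res_id T O W (fun=> id)).
have WW : W `<=` W by [].
rewrite (res_irr _ WW) (@coordP j _ _ _ _ WW (subset_trans h VU) a) ?res_id //.
exact: (bump1 (F := regular O) chiP).
Qed.

End Frames.

(** * Splitting and comparison *)

Lemma has_bumps_hom (T : topologicalType) (O O' : grRing T)
    (phi : grRingHom O O') : has_bumps O -> has_bumps O'.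
Proof.
move=> H U x Ux; have [V [chi [Vx [VU c1 [Z [UZ c0]]]]]] := H U x Ux.
exists V, (phi full 0 chi); split=> //; split=> //.
  by rewrite /glob_res -hom_res -/(glob_res V chi) c1 ring_hom1.
by exists Z; split=> //; rewrite /glob_res -hom_res -/(glob_res Z chi) c0 raddf0.
Qed.

Lemma comp_slin (T : topologicalType) (O1 O2 O3 : grRing T)
    (phi : forall U i, O1 U i -> O2 U i) (psi : forall U i, O2 U i -> O3 U i)
    (F : grModule O1) (G : grModule O2) (H : grModule O3)
    (f : grHom F G) (g : grHom G H) :
  slin phi f -> slin psi g -> slin (fun U i a => psi U i (phi U i a)) (comp_hom g f).
Proof. by move=> fl gl U i j k e a s; rewrite /= fl gl. Qed.

(** Uniqueness in the universal property is global, whereas the hypothesis is local. After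
    multiplication by [chi] both maps agree on the image of [rho] everywhere, hence they are equal;
    over [V] the factor is 1. *)
Lemma pullback_ext (T : topologicalType) (O O' : grRing T)
    (phi : grRingHom O O') (B : grModule O) (B' : grModule O')
    (rho : grHom B B') (U V : openSet T) (chi : O' full 0)
    (F : grModule O') (f g : grHom B' F) :
  is_pullback phi rho -> grlinear f -> grlinear g -> is_bump U V chi ->
  eq_on U (comp_hom f rho) (comp_hom g rho) -> eq_on V f g.
Proof.
move=> [rho_lin univ] fl gl chiP fg W h k s.
have chi_lin (h1 : grHom B' F) : grlinear h1 -> grlinear (comp_hom (scale_hom F chi) h1).
  by move=> hl; exact: comp_slin hl (@scale_hom_slin _ _ F chi).
have [|h0 [_ _ h0_uniq]] := univ F (comp_hom (comp_hom (scale_hom F chi) f) rho).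
  move=> W1 i j l e a t; rewrite /= rho_lin.
  exact: (chi_lin f fl).
rewrite -(bump1 chiP (f W k s) h) -(bump1 chiP (g W k s) h).
have /= -> := h0_uniq (comp_hom (scale_hom F chi) f) (chi_lin f fl)
  (fun _ _ _ => erefl) W k s.
rewrite -(h0_uniq (comp_hom (scale_hom F chi) g)) //; first exact: chi_lin.
move=> W1 l b /=; exact/esym/(eq_on_bump chiP fg).
Qed.

(** * Gluing homomorphisms, and countable covers *)

Section Local.
Variables (T : topologicalType).

Lemma hom_glue (F G : grSheaf T) (I : Type) (V : I -> openSet T)
    (h : I -> grHom F G) :
  (forall x, exists i, pts (V i) x) ->
  (forall i j (W : openSet T), W `<=` V i -> W `<=` V j ->
     forall k (s : F W k), h i W k s = h j W k s) ->
  exists g : grHom F G, forall i, eq_on (V i) g (h i).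
Proof.
move=> cov compat.
have ex U k (s : F U k) : exists t : G U k,
    forall i (W : openSet T) (hW : W `<=` U), W `<=` V i ->
      res G hW k t = h i W k (res F hW k s).
  pose Q (W : openSet T) (t : G W k) := exists i (hW : W `<=` U),
     W `<=` V i /\ t = h i W k (res F hW k s).
  have [||t Ht] := @glue_rel T G U k Q.
  - move=> x Ux; have [i Vx] := cov x.
    have hW : openSetI U (V i) `<=` U by move=> y [].
    exists (openSetI U (V i)); eexists; split=> //.
    by exists i, hW; split; [move=> y []|reflexivity].
  - move=> W1 W2 W h1 h2 s1 s2 _ _ [i [k1 [v1 ->]]] [j [k2 [v2 ->]]].
    rewrite -!hom_res !res_res (compat i j); last 2 first.
    + exact: subset_trans v1.
    + exact: subset_trans v2.
    by congr (h _ _ _ _); exact: res_irr.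
  by exists t => i W hW hV; apply: Ht; exists i, hW.
pose g U k (s : F U k) := projT1 (cid (ex U k s)).
have gP U k (s : F U k) i (W : openSet T) (hW : W `<=` U) : W `<=` V i ->
    res G hW k (g U k s) = h i W k (res F hW k s).
  by rewrite /g; case: cid => t /= Ht; exact: Ht.
(* The local values determine [g]; additivity and compatibility with restriction both follow from
   this. *)
have gE U k (s : F U k) (t : G U k) :
    (forall i (W : openSet T) (hW : W `<=` U), W `<=` V i ->
      res G hW k t = h i W k (res F hW k s)) -> g U k s = t.
  move=> Ht; apply: section_eq => x Ux; have [i Vx] := cov x.
  have hW : openSetI U (V i) `<=` U by move=> y [].
  have hV : openSetI U (V i) `<=` V i by move=> y [].
  by exists (openSetI U (V i)), hW; split=> //; rewrite (Ht i) // (gP _ _ _ i).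
have gB U k : zmod_morphism (g U k).
  by move=> s t; apply: gE => i W hW hV; rewrite !raddfB !(gP _ _ _ i).
have gres (U U' : openSet T) (hU : U' `<=` U) k (s : F U k) :
    g U' k (res F hU k s) = res G hU k (g U k s).
  by apply: gE => i W hW hV; rewrite !res_res (gP _ _ _ i).
exists (MkHom gB gres) => i W hW k s /=.
by have WW : W `<=` W by []; rewrite -(res_id WW (g W k s)) (gP _ _ _ i) // res_id.
Qed.

Lemma slin_local (O O' : grRing T) (phi : grRingHom O O')
    (F : grModule O) (G : grModule O') (I : Type) (V : I -> openSet T)
    (h : I -> grHom F G) (g : grHom F G) :
  (forall x, exists i, pts (V i) x) ->
  (forall i, eq_on (V i) g (h i)) ->
  (forall i, slin (fun U k a => phi U k a) (h i)) ->
  slin (fun U k a => phi U k a) g.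
Proof.
move=> cov gh hl U i j k e a s; apply: section_eq => x Ux.
have [l Vx] := cov x.
have hW : openSetI U (V l) `<=` U by move=> y [].
have hV : openSetI U (V l) `<=` V l by move=> y [].
exists (openSetI U (V l)), hW; split=> //.
by rewrite res_act -!hom_res !(gh l) // res_act hl.
Qed.

(** Since [Q] passes to smaller sets, every point has a neighbourhood satisfying [Q] that belongs to
    a countable basis. *)
Lemma countable_cover (A : Type) (a0 : A) (Q : openSet T -> A -> Prop) :
  @second_countable T ->
  (forall (V W : openSet T) a, W `<=` V -> Q V a -> Q W a) ->
  Q (OpenSet open0) a0 ->
  (forall x, exists (V : openSet T) a, pts V x /\ Q V a) ->
  exists (V : nat -> openSet T) (a : nat -> A),
    (forall x, exists n, pts (V n) x) /\ (forall n, Q (V n) (a n)).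
Proof.
move=> [S /countable_injP [f f_inj] [S_open S_basis]] QW Q0 cov.
have ex n : exists Va : openSet T * A, Q Va.1 Va.2 /\
    ((exists (V : openSet T) a, [/\ S V, f V = n & Q V a]) ->
     S Va.1 /\ f Va.1 = n).
  have [[V [a [SV fV q]]]|no] :=
      pselect (exists (V : openSet T) a, [/\ S V, f V = n & Q V a]).
    by exists (V, a).
  (* Numbers that code no suitable basis set receive the empty set and [a0]. *)
  by exists (OpenSet open0, a0); split.
pose Va n := projT1 (cid (ex n)); have VaP n := projT2 (cid (ex n)).
exists (fun n => (Va n).1), (fun n => (Va n).2); split=> [x|n]; last first.
  by have [] := VaP n.
have [V [a [Vx q]]] := cov x.
have [|b [Sb bx] bV] := S_basis x V; first exact: open_nbhs_nbhs (conj (ptsP V) Vx).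
pose b' := OpenSet (S_open _ Sb).
(* The set chosen for the code of [b] is a basis set with the same code, so it is [b] by injectivity
   of [f]. *)
exists (f b); have [_ [|Sb' fb]] := VaP (f b).
  by exists b', a; split=> //; exact: QW q.
rewrite /Va (_ : pts _ = b) //; apply: f_inj => //; exact/mem_set.
Qed.

End Local.

(** * A global section of [rho], linear over the functions of degree 0 *)

Section Splitting.
Variables (T : topologicalType) (O0 O : grRing T).
Variables (p : grRingHom O0 O) (z : grRingHom O O0).
Hypothesis zp : forall U k (a : O0 U k), z U k (p U k a) = a.
Hypothesis z_inj : forall U k (a : O U k), k <= 0 -> z U k a = 0 -> a = 0.
Hypothesis bumps : has_bumps O0.
Hypothesis T_countable : @second_countable T.
Variables (B : grModule O) (E : grModule O0) (rho : grHom B E).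
Hypothesis rhoP : is_pullback z rho.
Variables (J : Type) (js : seq J) (d : J -> int).

Let pfun U i (a : O0 U i) : O U i := p U i a.

Section LocalSplitting.
Variables (V V' : openSet T) (chi : O0 full 0) (chiP : is_bump V V' chi).
Variables (e : forall j, B full (d j)) (c : forall j, grHom B (degree_shift O (d j))).
Hypothesis ec : dual_frame V js e c.

Let eps j : E full (d j) := rho full (d j) (e j).

(** Each [gam j] comes from the universal property applied to [z] after [c j]. The expansion in the
    [eps j] holds on the image of [rho] over [V], and [pullback_ext] carries it to all of [E] over
    [V']. *)
Lemma dual_pullback : exists gam : forall j, grHom E (degree_shift O0 (d j)),
  [/\ forall j, grlinear (gam j),
      forall j U k (b : B U k), gam j U k (rho U k b) = z U _ (c j U k b) &
      forall W : openSet T, W `<=` V' -> forall k (s : E W k),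
        s = lincomb js eps (fun j => gam j W k s)].
Proof.
have [c_lin c_span _] := ec.
have [rho_lin rho_univ] := rhoP.
have H j := rho_univ (degree_shift O0 (d j)) (comp_hom (shift_hom z (d j)) (c j))
  (comp_slin (c_lin j) (@shift_hom_slin _ _ _ z (d j))).
pose gam j := projT1 (cid (H j)).
have gamP j : [/\ grlinear (gam j) & forall U k (b : B U k),
    gam j U k (rho U k b) = z U _ (c j U k b)].
  by rewrite /gam; case: cid => g [].
exists gam; split=> [j|j|]; try by have [] := gamP j.
have gam_lin j : slin (fun U i a => a) (gam j) by have [] := gamP j.
apply: (pullback_ext (f := id_hom E) (g := lincomb_hom js eps gam) rhoP _ _ chiP) => //.
  exact: lincomb_hom_slin.
move=> W h k b /=; rewrite [in LHS](c_span W h k b) (slin_lincomb rho_lin).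
by apply: eq_lincomb => j; have [_ ->] := gamP j.
Qed.

(** The section replaces each [eps j] by [e j] and pulls the coefficients back along [p]; since [z]
    undoes [p], applying [rho] gives back the expansion in the [eps j]. *)
Lemma local_section : exists t : grHom E B, slin pfun t /\
  forall W : openSet T, W `<=` V' -> forall k (s : E W k), rho W k (t W k s) = s.
Proof.
have [gam [gam_lin _ gam_span]] := dual_pullback.
exists (lincomb_hom js e (fun j => comp_hom (shift_hom p (d j)) (gam j))).
split.
  apply: lincomb_hom_slin => j.
  exact: comp_slin (gam_lin j) (@shift_hom_slin _ _ _ p (d j)).
move=> W h k s; rewrite [RHS](gam_span W h k s) /= (slin_lincomb rhoP.1).
by apply: eq_lincomb => j; rewrite zp.
Qed.

End LocalSplitting.

Hypothesis B_dual : forall x, exists (V : openSet T) (e : forall j, B full (d j))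
  (c : forall j, grHom B (degree_shift O (d j))), pts V x /\ dual_frame V js e c.

Lemma global_section : exists t : grHom E B, slin pfun t /\
  forall U k (s : E U k), rho U k (t U k s) = s.
Proof.
pose Q (V : openSet T) (t : grHom E B) := slin pfun t /\
  forall W : openSet T, W `<=` V -> forall k (s : E W k), rho W k (t W k s) = s.
have [||x|V [t [cov tP]]] := @countable_cover T _ (zero_map E B) Q T_countable.
- move=> V W t h [tl ts]; split=> // W' h'; apply: ts; exact: subset_trans h.
- split=> [U i j k e a s|W h k s]; first by rewrite /= act0r.
  apply: section_eq => x /h [].
- have [V [e [c [Vx ec]]]] := B_dual x.
  have [V' [chi [V'x chiP]]] := bumps Vx.
  by have [t tP] := local_section chiP ec; exists V', t.
pose S := fix S n := if n is n'.+1 then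
    add_hom (S n') (comp_hom (t n') (sub_hom (id_hom E) (comp_hom rho (S n'))))
  else zero_map E B.
(* Each new term corrects the defect [id - rho S] over one more set, and is zero wherever the defect
   has already vanished. *)
have rhoS n m (W : openSet T) : W `<=` V n -> (n < m)%N ->
    forall k (s : E W k), rho W k (S m W k s) = s.
  move=> h; elim: m => // m IH; rewrite ltnS leq_eqVlt => /predU1P[<-|nm] k s /=.
    by rewrite raddfD (tP n).2 //= addrC subrK.
  by rewrite (IH nm) subrr !raddf0 addr0 IH.
have S_stable n m (W : openSet T) : W `<=` V n -> (n < m)%N ->
    forall k (s : E W k), S m W k s = S n.+1 W k s.
  move=> h; elim: m => // m IH; rewrite ltnS leq_eqVlt => /predU1P[<-//|nm] k s.
  by rewrite [LHS]/= (rhoS n m) // subrr raddf0 addr0 IH.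
have S_lin n : slin pfun (S n).
  elim: n => [|n IH] U i j k e a s; first by rewrite /= act0r.
  rewrite /= actDr; congr (_ + _); first exact: IH.
  rewrite -(tP n).1 actBr; congr (t n _ _ (_ - _)).
  (* The composite of [rho] and [S n] is linear over [O0] because [z] undoes [p]. *)
  by rewrite IH rhoP.1 /pfun zp.
(* Over [V n] the sequence is constant from index [n.+1] on, the first one at which the correction
   by [t n] is included. *)
have [||sig sigE] := @hom_glue T E B nat V (fun n => S n.+1) => //.
  move=> n m W hn hm k s; wlog nm : n m hn hm / (n <= m)%N.
    by move=> H; case/orP: (leq_total n m) => nm; [|symmetry]; exact: H.
  by symmetry; exact: S_stable.
exists sig; split; first exact: slin_local cov sigE (fun n => S_lin n.+1).
move=> U k s; apply: section_eq => x Ux.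
have [n Vx] := cov x.
have hW : openSetI U (V n) `<=` U by move=> y [].
have hV : openSetI U (V n) `<=` V n by move=> y [].
exists (openSetI U (V n)), hW; split=> //.
by rewrite -!hom_res (sigE n) // (rhoS n).
Qed.

(** * Invertibility of the comparison map from the pullback of [E] to [B] *)

Section Comparison.
Variables (P : grModule O) (iota : grHom E P) (iotaP : is_pullback p iota).
Variables (sig : grHom E B) (sig_lin : slin pfun sig).
Hypothesis sigK : forall U k (s : E U k), rho U k (sig U k s) = s.
Variables (g : grHom P B) (g_lin : grlinear g).
Hypothesis g_iota : forall U k (s : E U k), g U k (iota U k s) = sig U k s.
Variables (lo : int) (L : nat).
Hypothesis d_bounds : forall j, lo <= d j < lo + L%:Z.

Section LocalComparison.
Variables (V V' : openSet T) (chi : O0 full 0) (chiP : is_bump V V' chi).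
Variables (e : forall j, B full (d j)) (c : forall j, grHom B (degree_shift O (d j))).
Hypothesis ec : dual_frame V js e c.

(** Over [V] this is the linear endomorphism that sends [e j] to [sig (rho (e j))]. *)
Let theta := lincomb_hom js (fun j => sig full _ (rho full _ (e j))) c.
Let eta := sub_hom (id_hom B) theta.

(** Only terms with [d j <= q] survive in [b], and [eta] replaces [e j] by [e j - sig (rho (e j))],
    which [rho] kills. Its coordinates of index degree at least [q] have degree at most 0 and are
    killed by [z], hence vanish. *)
Lemma eta_filtration (q : int) (W : openSet T) k (b : B W k) : W `<=` V ->
  (forall j, q + 1 <= d j -> c j W k b = 0) ->
  forall j, q <= d j -> c j W k (eta W k b) = 0.
Proof.
move=> WV b0 i qi; have [c_lin c_span _] := ec.
have [gam [_ gamP _]] := dual_pullback chiP ec.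
rewrite /= {1}(c_span W WV k b) /lincomb -sumrB raddf_sum big1 // => j _.
rewrite -actBr; have [jq|jq] := leP (q + 1) (d j).
  by rewrite b0 // act0l raddf0.
rewrite c_lin /glob_res -raddfB hom_res.
(* This coordinate has degree [d j - d i], which is at most 0 because [d j <= q <= d i]. *)
suff -> : c i full (d j) (e j - sig full (d j) (rho full (d j) (e j))) = 0.
  by rewrite raddf0 act0r.
apply: z_inj; first by rewrite subr_le0; apply: le_trans qi; rewrite -ltzD1.
by rewrite -gamP raddfB sigK subrr raddf0.
Qed.

Let etas r := iter r (comp_hom eta) (id_hom B).

(** No index has degree [lo + L] or more, and each application of [eta] lowers this bound by one.
    After [L] steps the bound is [lo], so every coordinate is zero. *)
Lemma etas_filtration r (W : openSet T) k (b : B W k) : W `<=` V ->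
  forall j, lo + L%:Z - r%:Z <= d j -> c j W k (etas r W k b) = 0.
Proof.
move=> WV; elim: r => [|r IH] j.
  by rewrite subr0 leNgt; have /andP[_ ->] := d_bounds j.
rewrite -addn1 PoszD opprD addrA addn1 /= => H.
apply: (eta_filtration WV) H => i; rewrite subrK; exact: IH.
Qed.

Lemma etas_nilpotent (W : openSet T) k (b : B W k) : W `<=` V -> etas L W k b = 0.
Proof.
move=> WV; have [_ c_span _] := ec.
rewrite (c_span W WV k (etas L W k b)) /lincomb big1 // => j _.
by rewrite etas_filtration ?act0l // addrK; have /andP[] := d_bounds j.
Qed.

Let thetaE (W : openSet T) k (b : B W k) : theta W k b = b - eta W k b.
Proof. by rewrite /= subKr. Qed.

(** The geometric series: the sum of the powers of [eta] with exponent below [r]. Since [theta] is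
    [id - eta], composing with [theta] telescopes to the identity minus [etas r]. *)
Let geom r := iter r (fun f => add_hom (id_hom B) (comp_hom eta f)) (zero_map B B).

Let geomS r (W : openSet T) k (b : B W k) :
  geom r.+1 W k b = b + eta W k (geom r W k b).
Proof. by []. Qed.

Lemma theta_geom (W : openSet T) k (b : B W k) : W `<=` V ->
  theta W k (geom L W k b) = b.
Proof.
move=> WV; suff H r : theta W k (geom r W k b) = b - etas r W k b.
  by rewrite H etas_nilpotent // subr0.
elim: r => [|r]; first by rewrite [RHS]subrr; exact: (raddf0 (theta W k)).
rewrite !thetaE geomS -[etas r.+1 W k b]/(eta W k (etas r W k b)) => IH.
by rewrite (raddfD (eta W k)) opprD addrACA -(raddfB (eta W k)) IH
  (raddfB (eta W k)) addrA subrK.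
Qed.

Lemma geom_theta (W : openSet T) k (b : B W k) : W `<=` V ->
  geom L W k (theta W k b) = b.
Proof.
move=> WV; suff H r : geom r W k (theta W k b) = b - etas r W k b.
  by rewrite H etas_nilpotent // subr0.
elim: r => [|r IH]; first by rewrite /= subrr.
rewrite geomS IH thetaE -[etas r.+1 W k b]/(eta W k (etas r W k b)).
by rewrite (raddfB (eta W k)) addrA subrK.
Qed.

Let q0 := lincomb_hom js (fun j => iota full _ (rho full _ (e j))) c.
Let q := comp_hom q0 (geom L).

(** By [g_iota], the map [g] after [q0] is [theta], so [theta_geom] applies. *)
Lemma g_q (W : openSet T) k (b : B W k) : W `<=` V -> g W k (q W k b) = b.
Proof.
move=> WV; rewrite -[RHS](theta_geom b WV) /= (slin_lincomb g_lin).
by rewrite /lincomb; apply: eq_bigr => j _; rewrite g_iota.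
Qed.

(** By [pullback_ext] it suffices to test on [iota s]. There [g] gives [sig s], which is [theta] of
    the combination of the [e j] with the coordinates of [s] pulled back along [p]; the series
    undoes [theta], and [q0] turns [e j] into [iota (rho (e j))]. *)
Lemma q_g (V'' : openSet T) (chi' : O full 0) : is_bump V' V'' chi' ->
  forall (W : openSet T) k (s : P W k), W `<=` V'' -> q W k (g W k s) = s.
Proof.
move=> chiP' W k s WV''; have [c_lin c_span c_comb] := ec.
have [gam [gam_lin _ gam_span]] := dual_pullback chiP ec.
have id_lin : grlinear (id_hom B) by [].
have theta_lin : grlinear theta by exact: lincomb_hom_slin.
have geom_lin r : grlinear (geom r).
  elim: r => [|r IH] U i j l ee a b; first by rewrite /= act0r.
  by rewrite !geomS IH actDr -[eta U l _]/(_ - theta U l _) theta_lin -actBr.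
have q0_lin : grlinear q0 by exact: lincomb_hom_slin.
have q_lin : grlinear (comp_hom q g).
  apply: (comp_slin (psi := fun U i a => a) g_lin).
  exact: comp_slin (geom_lin L) q0_lin.
apply: (pullback_ext (f := comp_hom q g) (g := id_hom P)
  iotaP q_lin _ chiP' _ WV'') => //.
move=> {WV'' W k s} W WV' k s.
have WV : W `<=` V by case: chiP => h _ _; exact: subset_trans h.
pose a j := p W _ (gam j W k s).
have -> : comp_hom (comp_hom q g) iota W k s = q0 W k (geom L W k (sig W k s)).
  by rewrite /= g_iota.
have -> : sig W k s = theta W k (lincomb js e a).
  rewrite [in LHS](gam_span W WV' k s) (slin_lincomb sig_lin) /=.
  by apply: eq_lincomb => j; rewrite c_comb.
rewrite geom_theta // [RHS]/= [in RHS](gam_span W WV' k s) (slin_lincomb iotaP.1).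
by apply: eq_lincomb => j; rewrite c_comb.
Qed.

End LocalComparison.

(** Two shrinkings occur: to [V1] for expanding sections of [E] in the images of the frame, and to
    [V2] for testing maps out of [P] on the image of [iota]. *)
Lemma comparison_local_inverse x : exists (V : openSet T) (q : grHom B P),
  [/\ pts V x, eq_on V (comp_hom g q) (id_hom B) & eq_on V (comp_hom q g) (id_hom P)].
Proof.
have [V [e [c [Vx ec]]]] := B_dual x.
have [V1 [chi1 [V1x chi1P]]] := bumps Vx.
have [V2 [chi2 [V2x chi2P]]] := has_bumps_hom p bumps V1x.
have V12 : V2 `<=` V1 by case: chi2P.
have V01 : V1 `<=` V by case: chi1P.
exists V2; eexists; split; first exact: V2x.
- move=> W WV k s; apply: (g_q chi1P ec).
  exact: subset_trans (subset_trans V12 V01).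
- by move=> W WV k s; apply: (q_g chi1P ec chi2P).
Qed.

(** Injectivity is local. It also makes local preimages unique, so they glue to a preimage, and the
    local inverses never have to be compared with each other. *)
Lemma comparison_bijective U k : bijective (g U k).
Proof.
have loc_inj (W : openSet T) (s t : P W k) : g W k s = g W k t -> s = t.
  move=> st; apply: section_eq => x Wx.
  have [V [q [Vx _ qg]]] := comparison_local_inverse x.
  have hW : openSetI W V `<=` W by move=> y [].
  have hV : openSetI W V `<=` V by move=> y [].
  exists (openSetI W V), hW; split=> //.
  have qgE (u : P W k) : q _ _ (g _ _ (res P hW k u)) = res P hW k u.
    exact: (qg _ hV).
  by rewrite -[LHS]qgE -[RHS]qgE !hom_res st.
have surj (b : B U k) : exists s : P U k, g U k s = b.
  pose Q (W : openSet T) (s : P W k) :=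
    exists h : W `<=` U, g W k s = res B h k b.
  have [||s sP] := @glue_rel T P U k Q.
  - move=> x Ux; have [V [q [Vx gq _]]] := comparison_local_inverse x.
    have hU : openSetI U V `<=` U by move=> y [].
    have hV : openSetI U V `<=` V by move=> y [].
    exists (openSetI U V), (q _ k (res B hU k b)); split=> //.
    by exists hU; exact: (gq _ hV).
  - move=> W1 W2 W h1 h2 s1 s2 _ _ [k1 e1] [k2 e2]; apply: loc_inj.
    by rewrite !hom_res e1 e2 !res_res; exact: res_irr.
  exists s; apply: section_eq => x Ux.
  have [V [q [Vx gq _]]] := comparison_local_inverse x.
  have hU : openSetI U V `<=` U by move=> y [].
  have hV : openSetI U V `<=` V by move=> y [].
  exists (openSetI U V), hU; split=> //.
  rewrite -hom_res (sP _ hU (q _ k (res B hU k b))); first exact: (gq _ hV).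
  by exists hU; exact: (gq _ hV).
pose inv b := projT1 (cid (surj b)); have invK b := projT2 (cid (surj b)).
exists inv => [s|b]; last exact: invK.
by apply: loc_inj; exact: invK.
Qed.

End Comparison.

End Splitting.

(** * Smooth bump functions *)

Section Flat.
Variable R : realType.
Implicit Types p : {poly R}.

(** The polynomial factor in [x^-1] makes this family of functions closed under differentiation. *)
Definition flat p (x : R) : R :=
  if 0 < x then p.[x^-1] * expR (- x^-1) else 0.

Lemma exprn_le_expR n (u : R) : 0 <= u -> u ^+ n <= n`!%:R * expR u.
Proof.
move=> u0; have fg : 0 < n`!%:R :> R by rewrite ltr0n fact_gt0.
rewrite mulrC -ler_pdivrMr //; case: n fg => [|n] fg.
  by rewrite expr0 divr1 -expR0 ler_expR.
by apply: le_trans (expR_ge1Dxn n u0); rewrite lerDr.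
Qed.

Lemma horner_le_expR p : exists C : R, 0 <= C /\
  forall u, 0 <= u -> `|p.[u]| <= C * expR u.
Proof.
exists (\sum_(i < size p) `|p`_i| * i`!%:R); split.
  by apply: sumr_ge0 => i _; rewrite mulr_ge0.
move=> u u0; rewrite horner_coef (le_trans (ler_norm_sum _ _ _)) // mulr_suml.
apply: ler_sum => i _; rewrite normrM -mulrA ler_wpM2l //.
by rewrite ger0_norm ?exprn_ge0 // exprn_le_expR.
Qed.

(** The exponential dominates the polynomial ['X ^+ 2 * p]. The bound makes the difference quotient
    at 0 tend to 0. *)
Lemma flat_quadratic p : exists C : R, forall h, `|flat p h| <= C * h ^+ 2.
Proof.
have [C [C0 HC]] := horner_le_expR ('X ^+ 2 * p); exists C => h.
rewrite /flat; case: ltP => h0; last by rewrite normr0 mulr_ge0 // sqr_ge0.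
have hi : 0 < h^-1 by rewrite invr_gt0.
have := HC _ (ltW hi); rewrite hornerM hornerXn normrM => H.
rewrite normrM (ger0_norm (expR_ge0 _)) expRN ler_pdivrMr ?expR_gt0 //.
have -> : `|p.[h^-1]| = h ^+ 2 * (`|h^-1 ^+ 2| * `|p.[h^-1]|).
  rewrite [`|_ ^+ 2|]ger0_norm ?exprn_ge0 ?(ltW hi) // mulrA -exprMn.
  by rewrite divff ?gt_eqF // expr1n mul1r.
rewrite [leRHS](_ : _ = h ^+ 2 * (C * expR h^-1)); last by ring.
by rewrite ler_pM2l // exprn_gt0.
Qed.

Lemma is_derive_flat p (x : R) : is_derive x 1 (flat p) (flat ('X ^+ 2 * (p - p^`())) x).
Proof.
have [x0|x0|->] := ltgtP x 0.
- rewrite {2}/flat ltNge (ltW x0) /=.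
  have fE : \near x, cst 0 x = flat p x.
    have : \forall y \near x, y < 0 by exact: lt_nbhsl.
    by apply: filterS => y y0; rewrite /flat ltNge (ltW y0).
  exact: near_eq_is_derive fE (is_derive_cst _ _ _).
- rewrite {2}/flat x0 /=.
  have fE : \near x, p.[x^-1] * expR (- x^-1) = flat p x.
    have : \forall y \near x, 0 < y by exact: lt_nbhsr.
    by apply: filterS => y y0; rewrite /flat y0.
  apply: near_eq_is_derive fE _.
  have xn0 : x != 0 by rewrite gt_eqF.
  have dinv : is_derive x 1 (fun y : R => y^-1) (- x ^- 2).
    have := @is_deriveV R id x 1 1 xn0 (is_derive_id _ _).
    by rewrite /GRing.scale /= mulr1.
  have d1 : is_derive x 1 (fun y => p.[y^-1]) (p^`().[x^-1] * - x ^- 2).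
    exact: (is_derive1_comp (is_derive_poly p x^-1) dinv).
  have d2 : is_derive x 1 (fun y => expR (- y^-1)) (expR (- x^-1) * x ^- 2).
    have dn : is_derive x 1 (fun y : R => - y^-1) (x ^- 2).
      by rewrite -[X in is_derive _ _ _ X]opprK; exact: is_deriveN.
    exact: (@is_derive1_comp _ expR (fun y : R => - y^-1) x _ _ (is_derive_expR _) dn).
  apply: is_derive_eq (is_deriveM d1 d2) _.
  rewrite hornerM hornerXn hornerD hornerN -exprVn /GRing.scale /=.
  ring.
- rewrite {2}/flat ltxx.
  have [C HC] := flat_quadratic p.
  have lim0 : h^-1 *: (flat p (h *: 1 + 0) - flat p 0) @[h --> 0^'] --> (0 : R).
    apply/cvgr0Pnorm_le => e e0.
    (* The sign of [C] is unknown, so [|C| + 1] serves as a positive divisor. *)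
    have C0 : 0 < `|C| + 1 by rewrite ltr_wpDl.
    near=> h.
    have hn0 : h != 0 by near: h; exact: nbhs_dnbhs_neq.
    have he : `|h| <= e / (`|C| + 1).
      by near: h; apply: (@dnbhs0_le _ R); rewrite divr_gt0.
    rewrite {2}/flat ltxx subr0 addr0 normrZ normfV [_ *: 1]mulr1.
    rewrite ler_pdivrMl ?normr_gt0 // (le_trans (HC h)) //.
    rewrite -real_normK ?num_real // expr2 mulrCA ler_pM2l ?normr_gt0 //.
    rewrite (le_trans (ler_wpM2r (normr_ge0 h) (ler_norm C))) //.
    apply: le_trans (_ : (`|C| + 1) * `|h| <= _); last by rewrite mulrC -ler_pdivlMr.
    by rewrite ler_wpM2r // lerDl.
  apply: DeriveDef; first by apply/cvg_ex; exists 0.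
  exact: cvg_lim lim0.
Unshelve. all: by end_near. Qed.

End Flat.

Section Chain.
Variables (R : realType) (V : normedModType R).

Lemma is_derive_line (f : V -> R) (x v : V) (df : R) :
  is_derive x v f df <-> is_derive (0 : R) 1 (fun h : R => f (h *: v + x)) df.
Proof.
have E : 'D_v f x = 'D_1 (fun h : R => f (h *: v + x)) 0.
  rewrite /derive; set g1 := fun h => h^-1 *: _; set g2 := fun h => h^-1 *: _.
  suff -> : g1 = g2 by []; apply/funext => h.
  by rewrite /g1 /g2 /= addr0 scale0r add0r [_ *: 1]mulr1.
split=> -[dx dE]; constructor; rewrite -?dE ?E //.
  by move/derivable1P: dx.
exact/derivable1P.
Qed.

(** Restricting to a line reduces this to the chain rule in one variable, so [f] needs only a
    derivative in the direction [v]; [Ck] supplies nothing stronger at once. *)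
Lemma is_derive_comp1 (F : R -> R) (f : V -> R) (x v : V) (dF df : R) :
  is_derive (f x) 1 F dF -> is_derive x v f df ->
  is_derive x v (F \o f) (dF * df).
Proof.
move=> HF /is_derive_line Hf; apply/is_derive_line.
apply: (@is_derive1_comp _ F (fun h : R => f (h *: v + x)) 0 _ _ _ Hf).
by rewrite scale0r add0r.
Qed.

End Chain.

Section SmoothCalculus.
Variables (R : realType) (n : nat).
Implicit Types (W : set 'rV[R]_n) (f g : 'rV[R]_n -> R).

Lemma CkS k W f : Ck k.+1 W f -> Ck k W f.
Proof.
elim: k f => [|k IH] f [cf df]; split=> // j.
by have [d1 d2] := df j; split=> //; exact: IH.
Qed.

(** The induction is general in [p], since each partial derivative is a product with another flat
    function composed with [g]. *)
Lemma Ck_flat k W g p : open W -> Ck k W g -> Ck k W (flat p \o g).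
Proof.
move=> oW; elim: k p g => [|k IH] p g Cg.
  split=> // x Wx; apply: continuous_comp; first exact: Cg.1.
  by have [dp _] := is_derive_flat p (g x);
    exact/differentiable_continuous/derivable1_diffP.
have [cg dg] := Cg.
have dcomp x j : W x -> is_derive x 'e_j (flat p \o g)
    (flat ('X ^+ 2 * (p - p^`())) (g x) * 'D_('e_j) g x).
  move=> Wx; apply: is_derive_comp1; first exact: is_derive_flat.
  exact: derivableP ((dg j).1 _ Wx).
split=> [x Wx|j].
  apply: continuous_comp; first exact: cg.
  by have [dp _] := is_derive_flat p (g x);
    exact/differentiable_continuous/derivable1_diffP.
split=> [x Wx|]; first by have [] := dcomp x j Wx.
apply: Ck_local => x Wx; exists W.
exists ((flat ('X ^+ 2 * (p - p^`())) \o g) * (fun y => 'D_('e_j) g y)).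
split=> //; last by move=> y Wy; have [_ ->] := dcomp y j Wy.
apply: CkM => //; first by apply: IH; exact: CkS Cg.
exact: (dg j).2.
Qed.

Lemma Ck_sum k W (I : Type) (r : seq I) (F : I -> 'rV[R]_n -> R) : open W ->
  (forall i, Ck k W (F i)) -> Ck k W (\sum_(i <- r) F i).
Proof.
move=> oW CF; elim: r => [|i r IH]; first by rewrite big_nil; exact: Ck_cst.
by rewrite big_cons; exact: CkD.
Qed.

End SmoothCalculus.

Section Step.
Variable R : realType.

(* A smooth step built from flat functions by composition alone: the inner
   [flat] vanishes on the left, and exceeds its value at 1 to the right of 1. *)
Definition step (t : R) : R :=
  flat (flat 1 (flat 1 1))^-1%:P (flat 1 1 - flat 1 t).

Lemma flat1E (x : R) : 0 < x -> flat 1 x = expR (- x^-1).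
Proof. by move=> x0; rewrite /flat x0 hornerC mul1r. Qed.

Lemma flat_le0 p (x : R) : x <= 0 -> flat p x = 0.
Proof. by move=> x0; rewrite /flat ltNge x0. Qed.

(** The constant coefficient of the outer [flat] normalizes its value at [flat 1 1], the inner
    argument for [t <= 0]. *)
Lemma step1 (t : R) : t <= 0 -> step t = 1.
Proof.
move=> t0; have c0 : 0 < flat 1 1 :> R by rewrite flat1E ?expR_gt0.
rewrite /step (flat_le0 _ t0) subr0 (flat1E c0) /flat c0 hornerC.
by rewrite mulVf // gt_eqF // expR_gt0.
Qed.

Lemma step0 (t : R) : 1 <= t -> step t = 0.
Proof.
move=> t1; have t0 : 0 < t by exact: lt_le_trans t1.
rewrite /step flat_le0 // subr_le0 !flat1E // ler_expR lerN2.
by rewrite lef_pV2 ?posrE.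
Qed.

Lemma Ck_step n k (W : set 'rV[R]_n) g : open W -> Ck k W g ->
  Ck k W (step \o g).
Proof.
move=> oW Cg; apply: Ck_flat => //.
rewrite (_ : (fun t => _) = (fun=> flat 1 1) + (fun=> -1) * (flat 1 \o g)).
  apply: CkD => //; first exact: Ck_cst.
  by apply: CkM => //; [exact: Ck_cst|exact: Ck_flat].
by apply/funext => x; rewrite /= !fctE mulN1r.
Qed.

End Step.

Section SquaredDistance.
Variables (R : realType) (n : nat).
Implicit Types y z : 'rV[R]_n.

(** The norm of row vectors is the maximum norm, which is not smooth; the squared Euclidean distance
    is polynomial. *)
Definition sqdist y z : R := \sum_j (z 0 j - y 0 j) ^+ 2.

Lemma sqdist_coord y z j : (z 0 j - y 0 j) ^+ 2 <= sqdist y z.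
Proof.
by rewrite /sqdist (bigD1 j) //= lerDl; apply: sumr_ge0 => i _; exact: sqr_ge0.
Qed.

Lemma sqdist_continuous y : continuous (sqdist y).
Proof.
move=> z.
have -> : sqdist y = \sum_j (fun z : 'rV[R]_n => (z 0 j - y 0 j) ^+ 2).
  by apply/funext => t; rewrite fct_sumE.
apply: (big_ind (fun f : 'rV[R]_n -> R => {for z, continuous f})).
- exact: cst_continuous.
- by move=> f g; exact: continuousD.
move=> j _; pose g (t : 'rV[R]_n) := t 0 j - y 0 j.
have cg : {for z, continuous g}.
  by apply: continuousB; [exact: coord_continuous|exact: cst_continuous].
exact: (continuousM cg cg).
Qed.

End SquaredDistance.

(** * Bump functions on a smooth manifold *)

Section ManifoldBumps.
Variables (R : realType) (M : smoothManifold R).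
Let n := mfd_dim M.

Lemma sqdist_smooth (c : chart R M n) y : atlas c ->
  smooth_on (chart_dom c) (sqdist y \o chart_map c).
Proof.
move=> ac d ad k.
have oW : open (chart_img d (chart_dom c)).
  exact/chart_img_open/chart_dom_open.
pose f j (z : 'rV[R]_n) := chart_map c (chart_inv d z) 0 j.
pose h j := f j + (fun=> - y 0 j).
have Ch j : Ck k (chart_img d (chart_dom c)) (h j).
  by apply: CkD => //; [exact: atlas_compatible|exact: Ck_cst].
rewrite (_ : _ \o _ = \sum_j h j * h j).
  by apply: Ck_sum => // j; exact: CkM.
by apply/funext => z; rewrite /= /sqdist fct_sumE.
Qed.

(** The bump is a smooth step of the squared distance in a chart, extended by zero outside a compact
    ball. *)
Lemma manifold_bumps : has_bumps (smooth_functions M).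
Proof.
move=> U x Ux.
have [c ac cx] := atlas_cover x.
pose y := chart_map c x.
have oA := chart_img_open (c := c) (ptsP U).
have Ay : chart_img c U y by split; [exact: chart_mapP|rewrite /= chart_mapK].
have /nbhs_ballP[/= e e0 eA] : nbhs y (chart_img c U) by exact: open_nbhs_nbhs.
pose r := (e / 2) ^+ 2.
have e20 : 0 < e / 2 by rewrite divr_gt0.
have r0 : 0 < r by rewrite exprn_gt0.
pose D := [set z | sqdist y z <= r].
(* The metric ball is a cube: each coordinate of [z - y] is at most [e / 2] in absolute value, by
   the choice of [r]. *)
have ball_e z : D z -> ball y e z.
  move=> Dz; split=> // i j; rewrite (ord1 i) /ball /=.
  apply: le_lt_trans (_ : e / 2 < e); last by rewrite ltr_pdivrMr // ltr_pMr // ltr1n.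
  rewrite distrC -ler_sqr ?nnegrE ?(ltW e20) // real_normK ?num_real //.
  exact: le_trans (sqdist_coord y z j) Dz.
have cD : closed D.
  apply: (@closed_comp _ _ (sqdist y) [set t | t <= r]); last exact: closed_le.
  by move=> z _; exact: sqdist_continuous.
have bD : bounded_set D.
  exists (`|y| + e); split; first exact: num_real.
  move=> N yN z /ball_e; rewrite -ball_normE /ball_ /= => yz.
  apply: le_trans (ltW yN); rewrite -[z](subKr y).
  by apply: le_trans (ler_normB _ _) _; rewrite lerD2l ltW.
have DA : D `<=` chart_img c U by move=> z /ball_e /eA.
pose K := chart_inv c @` D.
(* Closedness in all of [M], not only in the chart, makes the extension by zero smooth; it is here
   that the Hausdorff property enters. *)
have cK : closed K.
  apply: compact_closed; first exact: mfd_hausdorff.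
  apply: continuous_compact; last exact: bounded_closed_compact.
  apply: continuous_in_subspaceT => z /set_mem /DA [cz _].
  exact: chart_inv_cont.
have KU : K `<=` U by move=> _ [z /DA [_ Uz] <-].
have Kc : K `<=` chart_dom c by move=> _ [z /DA [cz _] <-]; exact: chart_invP.
pose q p := sqdist y (chart_map c p).
have KP p : chart_dom c p -> K p <-> q p <= r.
  move=> cp; split=> [[z Dz <-]|qp].
    by rewrite /q chart_invK //; exact: (DA _ Dz).1.
  by exists (chart_map c p) => //; rewrite chart_mapK.
(* The affine rescaling sends [q p = r / 2] to 0 and [q p = r] to 1, so the step is 1 up to [r / 2]
   and 0 from [r] on. *)
pose f p := 2 / r * q p - 1.
pose psi p := if `[< K p >] then step (f p) else 0.
have psiE p : chart_dom c p -> psi p = step (f p).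
  move=> cp; rewrite /psi; case: asboolP => // nK; rewrite step0 //.
  have rq : r < q p by rewrite ltNge; apply/negP => /(KP _ cp).
  rewrite /f lerBrDr mulrAC ler_pdivlMr // -[1 + 1]/(2 : R) ler_pM2l //.
  exact: ltW.
have oZ : open (~` K) by exact: closed_openC.
have f_smooth : smooth_on (chart_dom c) (@step R \o f).
  move=> d ad k; have oW : open (chart_img d (chart_dom c)).
    exact/chart_img_open/chart_dom_open.
  apply: (@Ck_step _ _ _ _ (f \o chart_inv d)) => //.
  rewrite (_ : f \o _ = (fun=> 2 / r) * (q \o chart_inv d) + (fun=> - 1)) //.
  apply: CkD; [by []| |exact: Ck_cst].
  by apply: CkM; [by []|exact: Ck_cst|exact: sqdist_smooth].
(* The chart domain, where [psi] is the step, and the complement of [K], where it is 0, form an open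
   cover. *)
have psi_smooth : smooth_on setT psi.
  apply: smooth_on_local => p _; have [Kp|Kp] := pselect (K p).
    exists (chart_dom c), (@step R \o f); split=> //.
    - exact: chart_dom_open.
    - exact: Kc.
  exists (~` K), (fun=> 0); split=> //; first exact: smooth_on_cst.
  by move=> p' Kp'; rewrite /psi asboolF.
have psiP : psi \in smoothfun_pred (full : openSet M) 0.
  by apply/asboolP; split=> // p [].
have oV : open (chart_dom c `&` [set p | q p < r / 2]).
  rewrite openE => p [cp qp]; rewrite /interior.
  apply: filterI; first by apply: open_nbhs_nbhs; split=> //; exact: chart_dom_open.
  have H : {for p, continuous (sqdist y \o chart_map c)}.
    by apply: continuous_comp; [exact: chart_map_cont|exact: sqdist_continuous].
  by apply: (H [set t | t < r / 2]); exact: lt_nbhsl.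
exists (OpenSet oV), (SmoothFun psiP); split.
  split=> //=; rewrite /q /sqdist big1 ?divr_gt0 // => j _.
  by rewrite subrr expr0n.
split.
- move=> p [cp qp]; apply: KU; apply/(KP _ cp)/ltW/(lt_le_trans qp).
  by rewrite ler_pdivrMr // ler_pMr // ler1n.
- apply: smoothfun_eq => p [cp qp]; rewrite smoothfun_resE //= cutE //.
  rewrite psiE // step1 // /f subr_le0 mulrAC ler_pdivrMr // mul1r.
  by rewrite mulrC -ler_pdivlMr // ltW.
- exists (OpenSet oZ); split=> [p|].
    by have [/KU|] := pselect (K p); [left|right].
  by apply: smoothfun_eq => p Kp; rewrite smoothfun_resE //= /psi asboolF.
Qed.

End ManifoldBumps.

(** The comparison map runs from the pullback to [B], while the isomorphism is sought in the other
    direction. *)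
Lemma inverse_hom (T : topologicalType) (O : grRing T) (F G : grModule O)
    (g : grHom F G) : grlinear g -> (forall U k, bijective (g U k)) ->
  exists f : grHom G F, grlinear f /\ forall U k, bijective (f U k).
Proof.
move=> gl gb.
have H U k : {h : G U k -> F U k | cancel (g U k) h /\ cancel h (g U k)}.
  by apply: cid; have [h h1 h2] := gb U k; exists h.
pose h U k := sval (H U k).
have gK U k : cancel (g U k) (h U k) := (svalP (H U k)).1.
have hK U k : cancel (h U k) (g U k) := (svalP (H U k)).2.
have hB U k : zmod_morphism (h U k).
  by move=> s t; apply: (can_inj (gK U k)); rewrite raddfB !hK.
have hres (U V : openSet T) (i : V `<=` U) k (s : G U k) :
    h V k (res G i k s) = res F i k (h U k s).
  by apply: (can_inj (gK V k)); rewrite hom_res !hK.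
exists (MkHom hB hres); split=> [U i j k e a s|U k].
  by apply: (can_inj (gK U k)); rewrite gl !hK.
by exists (g U k) => s; [exact: hK|exact: gK].
Qed.

(** Finite ranks and bounded degrees make the index type of a frame finite, so frames give sums over
    one fixed list. *)
Lemma enum_bounded_degrees (rk : int -> nat) (m n : int) :
  (forall i, (i < m) || (n < i) -> rk i = 0%N) ->
  exists js : seq {i : int & 'I_(rk i)}, uniq js /\ forall j, j \in js.
Proof.
move=> rk0.
(* The degrees listed are those from [m] to [n]. If [n + 1 < m], the absolute value lists spurious
   degrees, but then all ranks are 0. *)
pose L := absz (n + 1 - m)%R.
exists (undup (flatten [seq [seq Tagged (fun i => 'I_(rk i)) a |
    a <- enum 'I_(rk i)] | i <- [seq m + r%:Z | r <- iota 0 L]])).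
split=> [|[i a]]; first exact: undup_uniq.
have := rk0 i; case: (boolP (_ || _)) => [_ /(_ isT) rki|].
  by exfalso; case: a => a; rewrite rki.
rewrite negb_or -!leNgt => /andP[mi in_] _.
rewrite mem_undup; apply/flattenP.
exists [seq Tagged (fun i => 'I_(rk i)) b | b <- enum 'I_(rk i)]; last first.
  by apply/mapP; exists a; rewrite ?mem_enum.
apply/mapP; exists i => //; apply/mapP; exists (absz (i - m)%R).
  rewrite mem_iota /= add0n -ltz_nat /L !gez0_abs ?subr_ge0 //.
    by rewrite ltrBlDr subrK ltzD1.
  by rewrite (le_trans mi) // (le_trans in_) // lerDl.
by rewrite gez0_abs ?subr_ge0 // addrC subrK.
Qed.

(** As a pullback is determined only up to isomorphism, [E] and [P] range over all vector bundles
    with the universal property. *)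
Theorem theorem2p1 (R : realType) (N : nManifold R) (B : vectorBundle N)
    (B_bounded : degree_bounded B)
    (E : vectorBundle (smooth_functions (base N))) (rho : grHom B E)
    (E_pullback : is_pullback (zero_embedding N) rho)
    (P : vectorBundle N) (iota : grHom E P)
    (P_pullback : is_pullback (projection N) iota) :
  vb_isomorphic B P.
Proof.
have [m [n rk0]] := B_bounded.
have [js [js_uniq js_all]] := enum_bounded_degrees rk0.
have bumps := @manifold_bumps R (base N).
have zp U k (a : smooth_functions (base N) U k) :
  zero_embedding N U k (projection N U k a) = a := zero_funK a.
(* In degree 0 the zero embedding is inverse to the projection, and in negative degrees there are no
   nonzero functions. *)
have z_inj U k (a : N U k) : k <= 0 -> zero_embedding N U k a = 0 -> a = 0.
  rewrite le_eqVlt => /predU1P[k0|k0] az; last exact: functions_lt0.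
  by subst k; rewrite -(projectionK a) -[zero_fun a]/(zero_embedding N U 0 a)
    az raddf0.
have dual (x : base N) : exists (V : openSet (base N))
    (e : forall j : {i : int & 'I_(rk B i)}, B full (tag j))
    (c : forall j, grHom B (degree_shift N (tag j))),
    pts V x /\ dual_frame V js e c.
  have [U [Ux [e eP]]] := local_frame B x.
  have [V [chi [Vx chiP]]] := has_bumps_hom (projection N) bumps Ux.
  have [e' [c ec]] := frame_dual eP js_uniq js_all chiP.
  by exists V, e', c.
have [sig [sig_lin sigK]] := global_section zp bumps
  (@mfd_second_countable _ (base N)) E_pullback dual.
have [g [g_lin g_iota _]] := P_pullback.2 B sig sig_lin.
apply: (inverse_hom g_lin) => U k.
(* With this [L], the strict upper bound [lo + L] is [n + 1] as soon as some rank is nonzero. *)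
apply: (comparison_bijective z_inj bumps E_pullback dual P_pullback
  sig_lin sigK g_lin g_iota (lo := m) (L := absz (n + 1 - m)%R)) => -[i a] /=.
have := rk0 i; case: (boolP (_ || _)) => [_ /(_ isT) rki|].
  by exfalso; case: a => a; rewrite rki.
rewrite negb_or -!leNgt => /andP[mi ni] _; rewrite mi /=.
rewrite gez0_abs; first by rewrite addrC subrK ltzD1.
by rewrite subr_ge0 (le_trans mi) // (le_trans ni) // lerDl.
Qed.
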